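(* Let $O\subset\mathbb{R}^d$ be a non-empty Greenian open set, and let $\vartheta,\mu$ be charges on $O$ with compact supports in $O$ such that $\mu$ is a balayage of $\vartheta$ for $\operatorname{sbh}(O)$. Then $$\int u\,d\vartheta\le\int u\,d\mu\quad\text{for all } u\in\operatorname{sbh}\bigl(\operatorname{hull-in}_O(\operatorname{supp}\mu\cup\operatorname{supp}\vartheta)\bigr),$$ i.e., if $O'\subset\mathbb{R}^d$ is an open set with $O'\supset\operatorname{hull-in}_O(\operatorname{supp}\mu\cup\operatorname{supp}\vartheta)$, then $\mu$ is an $\operatorname{sbh}(O')$-balayage of $\vartheta$.
   Context: $d\ge1$. A charge is a Borel (Radon) signed measure; charges with compact support are finite. An open set is Greenian if it possesses a Green function (equivalently, each of its connected components carries a non-constant positive superharmonic function). $\operatorname{sbh}(O)$ is the class of all subharmonic functions $O\to[-\infty,+\infty)$ on the open set $O$ (locally convex if $d=1$); it contains the function identically $-\infty$. For an arbitrary set $S$, $\operatorname{sbh}(S)$ is the class of restrictions to $S$ of functions subharmonic on some open set (depending on the function) containing $S$. The convention $0\cdot(\pm\infty)=0$ is used. Balayage: for charges $\vartheta,\mu$ and a class $H$ of Borel functions such that the integrals $\int h\,d\vartheta$, $\int h\,d\mu$ are well defined with values in $[-\infty,+\infty]$ for every $h\in H$ (this is part of the definition), $\mu$ is a balayage of $\vartheta$ for $H$ (an $H$-balayage of $\vartheta$) if $\int h\,d\vartheta\le\int h\,d\mu$ for all $h\in H$. Inward-filled hull: for a subset $K\subset O$, $\operatorname{hull-in}_O K$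 is the union of $K$ with all connected components $C$ of $O\setminus K$ whose closure in $O$ is a compact subset of $O$. *)

(* Defs.v *)
From mathcomp Require Export all_boot all_order all_algebra.
From mathcomp Require Export all_classical all_reals all_analysis.
From mathcomp Require Export measurable_realfun.
Export Order.TTheory GRing.Theory Num.Theory.
Export numFieldNormedType.Exports.

Set Implicit Arguments.
Unset Strict Implicit.
Unset Printing Implicit Defensive.

Local Open Scope classical_set_scope.
Local Open Scope ring_scope.

(* The library norm on ['rV[R]_d] is the sup norm; it induces the usual
   topology, but the fundamental solution needs the Euclidean norm. *)
Definition enorm (R : realType) (d : nat) (x : 'rV[R]_d) : R :=
  Num.sqrt (\sum_i x ord0 i ^+ 2).

(* A function on a subset [O] of R^d is represented by a total function whose
   values outside [O] are irrelevant. *)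

Definition partial (R : realType) (d : nat) (i : 'I_d) (h : 'rV[R]_d -> R) :
    'rV[R]_d -> R :=
  'D_(delta_mx ord0 i) h.

(* Existence and continuity of all second-order partial derivatives at every
   point of the open set [G]; this implies that the first-order ones are
   continuous. *)
Definition C2_on (R : realType) (d : nat) (G : set 'rV[R]_d)
    (h : 'rV[R]_d -> R) : Prop :=
  forall x, G x ->
    {for x, continuous h} /\
    forall i j : 'I_d,
      [/\ derivable h x (delta_mx ord0 i),
          derivable (partial i h) x (delta_mx ord0 j) &
          {for x, continuous (partial j (partial i h))}].

Definition harmonic (R : realType) (d : nat) (G : set 'rV[R]_d)
    (h : 'rV[R]_d -> R) : Prop :=
  C2_on G h /\ forall x, G x -> \sum_(i < d) partial i (partial i h) x = 0.

(* F. Riesz's definition: [u] is upper semicontinuous on the open set [O], with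
   values in [-oo, +oo[, and lies below every harmonic function that dominates
   it on the boundary of a relatively compact open subset.  The constant -oo is
   allowed.  For d = 1 harmonic functions are locally affine, so that the last
   condition says that [u] lies below its chords, i.e., is locally convex. *)
Definition subharmonic (R : realType) (d : nat) (O : set 'rV[R]_d)
    (u : 'rV[R]_d -> \bar R) : Prop :=
  [/\ forall x, O x -> (u x < +oo)%E,
      forall x, O x -> forall a : R, (u x < a%:E)%E ->
        \forall y \near x, (u y < a%:E)%E
    & forall (G : set 'rV[R]_d) (h : 'rV[R]_d -> R),
        open G -> compact (closure G) -> closure G `<=` O ->
        {within closure G, continuous h} -> harmonic G h ->
        (forall x, (closure G `\` G) x -> (u x <= (h x)%:E)%E) ->
        forall x, G x -> (u x <= (h x)%:E)%E].

(* Meant for open sets [O]. *)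
Definition sbh (R : realType) (d : nat) (O : set 'rV[R]_d) :
    set ('rV[R]_d -> \bar R) :=
  [set u | subharmonic O u].

(* Restrictions to an arbitrary set [S] of functions subharmonic on some open
   set containing [S]. *)
Definition sbh_near (R : realType) (d : nat) (S : set 'rV[R]_d) :
    set ('rV[R]_d -> \bar R) :=
  [set u | exists (O' : set 'rV[R]_d) (v : 'rV[R]_d -> \bar R),
    [/\ open O', S `<=` O', sbh O' v & forall x, S x -> u x = v x]].

(* Fundamental superharmonic function with pole [y]: -|x - y| if d = 1,
   -ln |x - y| if d = 2, |x - y|^(2 - d) if d >= 3. *)
Definition fundamental (R : realType) (d : nat) (y x : 'rV[R]_d) : \bar R :=
  if d == 1%N then (- enorm (x - y))%:E
  else if x == y then +oo%E
  else if d == 2%N then (- ln (enorm (x - y)))%:E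
  else (enorm (x - y) ^- (d - 2))%:E.

Definition greatest_harmonic_minorant (R : realType) (d : nat)
    (O : set 'rV[R]_d) (s : 'rV[R]_d -> \bar R) (h : 'rV[R]_d -> R) : Prop :=
  [/\ harmonic O h,
      forall x, O x -> ((h x)%:E <= s x)%E
    & forall h' : 'rV[R]_d -> R, harmonic O h' ->
        (forall x, O x -> ((h' x)%:E <= s x)%E) ->
        forall x, O x -> h' x <= h x].

(* [g x y]: the Green function of [O] at [x], with pole [y]. *)
Definition green_function (R : realType) (d : nat) (O : set 'rV[R]_d)
    (g : 'rV[R]_d -> 'rV[R]_d -> \bar R) : Prop :=
  forall y, O y -> exists2 h : 'rV[R]_d -> R,
    greatest_harmonic_minorant O (fundamental y) h &
    forall x, O x -> g x y = (fundamental y x - (h x)%:E)%E.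

Definition Greenian (R : realType) (d : nat) (O : set 'rV[R]_d) : Prop :=
  open O /\ exists g, green_function O g.

(* R^d with its Borel sigma-algebra.  A charge with compact support in an open
   set [O] is represented by its extension by zero to R^d. *)
Definition borelRd (R : realType) (d : nat) :
    measurableType (sigma_display (@open 'rV[R]_d)) :=
  g_sigma_algebraType (@open 'rV[R]_d).

Section Charges.
Context {R : realType} {d : nat}.
Implicit Types (nu : {charge set (borelRd R d) -> \bar R}).
Implicit Types (D : set 'rV[R]_d) (f : 'rV[R]_d -> \bar R).
Local Open Scope ereal_scope.

Lemma hahn_pair_ex nu :
  exists PN : set (borelRd R d) * set (borelRd R d),
    hahn_decomposition nu PN.1 PN.2.
Proof. by have [P [N PN]] := Hahn_decomposition nu; exists (P, N). Qed.

(* The Jordan decomposition does not depend on the Hahn decomposition chosen. *)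
Definition hahn_pair nu := projT2 (cid (hahn_pair_ex nu)).

Definition charge_pos nu := jordan_pos (hahn_pair nu).
Definition charge_neg nu := jordan_neg (hahn_pair nu).
Definition charge_abs nu := charge_variation (hahn_pair nu).

(* Complement of the largest open |nu|-null set. *)
Definition charge_supp nu : set 'rV[R]_d :=
  ~` \bigcup_(V in [set V : set 'rV[R]_d | open V /\ charge_abs nu V = 0]) V.

Definition charge_int_plus nu D f : \bar R :=
  \int[charge_pos nu]_(x in D) (f^\+ x) + \int[charge_neg nu]_(x in D) (f^\- x).

Definition charge_int_minus nu D f : \bar R :=
  \int[charge_pos nu]_(x in D) (f^\- x) + \int[charge_neg nu]_(x in D) (f^\+ x).

(* The integral of [f] over [D] exists in [-oo, +oo]. *)
Definition charge_int_def nu D f : Prop :=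
  measurable_fun (D : set (borelRd R d)) f /\
  ~ (charge_int_plus nu D f = +oo /\ charge_int_minus nu D f = +oo).

Definition charge_int nu D f : \bar R :=
  charge_int_plus nu D f - charge_int_minus nu D f.

(* [mu] is a balayage of [theta] for the class [H] of functions on [D]. *)
Definition balayage D (H : set ('rV[R]_d -> \bar R))
    (theta mu : {charge set (borelRd R d) -> \bar R}) : Prop :=
  forall h, H h ->
    [/\ charge_int_def theta D h, charge_int_def mu D h
      & charge_int theta D h <= charge_int mu D h].

End Charges.

Definition hull_in (R : realType) (d : nat) (O K : set 'rV[R]_d) :
    set 'rV[R]_d :=
  K `|` [set x | (O `\` K) x /\
    compact (closure (connected_component (O `\` K) x) `&` O)].

(* Main.v *)
(* No potential theory is needed beyond the maximum principle: a function
   subharmonic near the hull, once truncated below, coincides on the two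
   supports with a function that is subharmonic on all of [O].

   Call [s] a barrier if it is continuous and subharmonic on [O] and at most -1
   on the compact set [K], the union of the supports.  Every point of [O]
   outside the hull of [K] is a point of positivity of some barrier: a component
   of [O \ K] that is not relatively compact comes close to a point outside [O],
   where a pole can be put, or is unbounded, where [|x|^2] does the job; and
   positivity propagates along the component, since a pole at a point of
   positivity can be cut off by gluing.  By compactness a single barrier is
   positive on the whole boundary of a neighbourhood of the hull, so that a
   large multiple of it takes over from [u] across that boundary.

   The constant -oo is subharmonic, so that balayage forces each charge to be
   of one sign; the truncation is then removed by monotone convergence. *)
Require Import Defs.
From mathcomp Require Import ring lra.
Set Implicit Arguments.
Unset Strict Implicit.
Unset Printing Implicit Defensive.

Local Open Scope classical_set_scope.
Local Open Scope ring_scope.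

(** * Subharmonic functions *)

Lemma is_derive_line (R : realType) (V : normedModType R) (f : V -> R)
    (x v : V) (t df : R) :
  is_derive (t *: v + x) v f df ->
  is_derive t 1 (fun h : R => f (h *: v + x)) df.
Proof.
have E h : (h *: (1 : R) + t) *: v + x = h *: v + (t *: v + x).
  by rewrite scalerDl [h *: 1]mulr1 addrA.
case=> fd fdE; split.
  by rewrite /derivable/=; under eq_fun do rewrite E.
by rewrite -fdE /derive/=; under eq_fun do rewrite E.
Qed.

(** Along the line, [f1] vanishes at the maximum. Were [c] positive, [f1] would be positive just to
    the right of it, and the mean value theorem would lift [f] above its maximum. Differentiability
    of [f1] at the single point [x] is enough for this. *)
Lemma second_derivative_test (R : realType) (V : normedModType R)
    (f f1 : V -> R) (x v : V) (c e : R) :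
  0 < e ->
  (forall t : R, `|t| < e -> is_derive (t *: v + x) v f (f1 (t *: v + x))) ->
  is_derive x v f1 c ->
  (forall t : R, `|t| < e -> f (t *: v + x) <= f x) -> c <= 0.
Proof.
move=> e0 fd f1d fmax; rewrite leNgt; apply/negP => c0.
pose g (t : R) := f (t *: v + x).
have e_itv (t : R) : t \in `](- e), e[ -> `|t| < e by rewrite in_itv/= ltr_norml.
have gd (t : R) : `|t| < e -> is_derive t 1 g (f1 (t *: v + x)).
  by move=> /fd; exact: is_derive_line.
have g00 : is_derive (0 : R) 1 g 0.
  apply: (@derive1_at_max _ _ (- e) e).
  - by rewrite ltW// gtrN.
  - by move=> t /e_itv /gd[].
  - by rewrite in_itv/= oppr_lt0 e0.
  - by move=> t /e_itv /fmax; rewrite /g scale0r add0r.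
have f1x0 : f1 x = 0.
  have /gd : `|0 : R| < e by rewrite normr0.
  by rewrite scale0r add0r => -[_ <-]; case: g00.
have : (fun h : R => h^-1 *: (f1 (h *: v + x) - f1 x)) @ 0^' --> c.
  by case: f1d => dv <-; exact: dv.
rewrite f1x0 => /(_ [set y | 0 < y]) /= H.
have [r /= r0 Hr] := H (lt_nbhsr c0).
pose b := Num.min e r / 2.
have b0 : 0 < b by rewrite divr_gt0// lt_min e0 r0.
have me : b < Num.min e r by rewrite ltr_pdivrMr// ltr_pMr ?ltr1n// lt_min e0.
have [be br] : b < e /\ b < r by move: me; rewrite lt_min => /andP[].
have lte (t : R) : 0 <= t -> t <= b -> `|t| < e.
  by move=> t0 tb; rewrite ger0_norm//; exact: le_lt_trans be.
have [||t] := @MVT R g (fun t : R => f1 (t *: v + x)) 0 b b0.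
- by move=> t; rewrite in_itv/= => /andP[t0 tb]; apply/gd/lte; exact: ltW.
- apply: continuous_in_subspaceT => t; rewrite inE/= in_itv/= => /andP[t0 tb].
  apply: differentiable_continuous; apply/derivable1_diffP.
  by have /gd[] := lte _ t0 tb.
rewrite in_itv/= => /andP[t0 tb] gE.
have : 0 < g b - g 0.
  rewrite gE subr0 mulr_gt0//.
  (* Since [f1 x = 0], the difference quotient of [f1] is [f1 (t *: v + x) / t]; it is positive for
     small [t], by convergence to [c > 0]. *)
  have := Hr t; rewrite /ball_/= sub0r normrN gtr0_norm// subr0 => /(_ _ _).
  rewrite -(pmulr_rgt0 (f1 _) (x := t^-1)) ?invr_gt0//; apply => //.
  - exact: lt_trans br.
  - by rewrite gt_eqF.
by apply/negP; rewrite -leNgt subr_le0 /g scale0r add0r fmax// lte// ltW.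
Qed.

(** At an interior maximum of [f - h] every pure second derivative is at most 0, which contradicts
    the positive Laplacian. So the maximum over [closure G] lies on the boundary, where [f <= h]. *)
Lemma subharmonic_laplacian_gt0 (R : realType) (d : nat) (O : set 'rV[R]_d)
    (f : 'rV[R]_d -> R) (f1 f2 : 'I_d -> 'rV[R]_d -> R) :
  (forall x, O x -> {for x, continuous f}) ->
  (forall x i, O x -> is_derive x (delta_mx ord0 i) f (f1 i x)) ->
  (forall x i, O x -> is_derive x (delta_mx ord0 i) (f1 i) (f2 i x)) ->
  (forall x, O x -> 0 < \sum_(i < d) f2 i x) ->
  subharmonic O (fun x => (f x)%:E).
Proof.
move=> fc fd1 fd2 lap; split.
- by move=> x Ox; rewrite ltry.
- move=> x Ox a; rewrite lte_fin => fxa.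
  by near do rewrite lte_fin; exact: (cvgr_lt _ (fc _ Ox)).
move=> G h oG cG GO hc [hC2 hlap] fh x Gx; rewrite lee_fin.
pose w y := f y - h y.
have clGG : G `<=` closure G := @subset_closure _ G.
have wc : {within closure G, continuous w}.
  have fc' : {within closure G, continuous f}.
    by apply: continuous_in_subspaceT => y; rewrite inE => /GO /fc.
  by move=> y; apply: continuousB; [exact: fc'|exact: hc].
have [c /[!inE] cGc cmax] : exists2 c, c \in closure G &
    forall t, t \in closure G -> w t <= w c.
  by apply: EVT_max_rV => //; exists x; exact: clGG.
suff wc0 : w c <= 0.
  rewrite -subr_le0; apply: le_trans wc0; apply: cmax.
  by rewrite inE; exact: clGG.
have [Gc|nGc] := pselect (G c); last first.
  by rewrite subr_le0 -lee_fin; exact: fh.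
have: 0 < \sum_i (f2 i c - partial i (partial i h) c).
  by rewrite sumrB hlap// subr0; exact/lap/GO.
rewrite ltNge => /negP[]; apply: sumr_le0 => i _.
have [e /= e0 eG] : \forall t \near (0 : R), G (t *: delta_mx ord0 i + c).
  apply: (@near0Z _ _ _ (fun y => G (y + c))).
  rewrite (near_shift c) /=; near=> y; rewrite /= sub0r subrK.
  by near: y; exact: open_nbhs_nbhs.
have {}eG (t : R) : `|t| < e -> G (t *: delta_mx ord0 i + c).
  by move=> te; apply: eG; rewrite /ball_/= sub0r normrN.
apply: (@second_derivative_test _ _ w
  (fun y => f1 i y - partial i h y) c (delta_mx ord0 i) _ e) => //.
- move=> t /eG Gt; apply: is_deriveB; first exact/fd1/GO/clGG.
  by have [_ /(_ i i)[d1 _ _]] := hC2 _ Gt; exact: (derivableP d1).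
- apply: is_deriveB; first exact/fd2/GO.
  by have [_ /(_ i i)[_ d2 _]] := hC2 _ Gc; exact: (derivableP d2).
- by move=> t /eG /clGG Gt; apply: cmax; rewrite inE.
Unshelve. all: by end_near. Qed.

(** * Explicit strictly subharmonic functions: the squared Euclidean distance and its inverse
    powers *)

Definition sqdist (R : realType) (d : nat) (z x : 'rV[R]_d) : R :=
  \sum_i (x ord0 i - z ord0 i) ^+ 2.

Lemma is_derive_coordB (R : realType) (d : nat) (z x : 'rV[R]_d) (i j : 'I_d) :
  is_derive x (delta_mx ord0 i) (fun y : 'rV[R]_d => y ord0 j - z ord0 j)
    (i == j)%:R.
Proof.
have D : is_derive x (delta_mx ord0 i) (fun y : 'rV[R]_d => y ord0 j) (i == j)%:R.
  have /derivable_mxP/(_ ord0 j) dj := @derivable_id R 'rV[R]_d x (delta_mx ord0 i).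
  split => //.
  have := derive_mx (@derivable_id R 'rV[R]_d x (delta_mx ord0 i)).
  by rewrite derive_id => /matrixP/(_ ord0 j); rewrite !mxE eqxx/= eq_sym => <-.
rewrite -[X in is_derive _ _ _ X]subr0.
exact: is_deriveB.
Qed.

Lemma is_derive_sqdist (R : realType) (d : nat) (z x : 'rV[R]_d) (i : 'I_d) :
  is_derive x (delta_mx ord0 i) (sqdist z) (2 * (x ord0 i - z ord0 i)).
Proof.
rewrite [X in is_derive _ _ X _](_ : _ =
    \sum_(j < d) (fun y : 'rV[R]_d => y ord0 j - z ord0 j) ^+ 2); last first.
  by apply/funext => y; rewrite fct_sumE.
apply: is_derive_eq.
  by apply: is_derive_sum => j; apply: is_deriveX; exact: is_derive_coordB.
rewrite (bigD1 i)//= big1 ?addr0 => [|j /negPf ji].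
  by rewrite eqxx expr1 [LHS]mulr1.
by rewrite eq_sym ji [LHS]mulr0.
Qed.

Lemma continuous_sqdist (R : realType) (d : nat) (z : 'rV[R]_d) :
  continuous (sqdist z).
Proof.
move=> x; apply: differentiable_continuous.
rewrite (_ : sqdist z =
    \sum_(j < d) (fun y : 'rV[R]_d => y ord0 j - z ord0 j) ^+ 2); last first.
  by apply/funext => y; rewrite fct_sumE.
apply: differentiable_sum => i; apply: differentiableX.
by apply: differentiableB => //; exact: differentiable_coord.
Qed.

Lemma sqdist_ge0 (R : realType) (d : nat) (z x : 'rV[R]_d) : 0 <= sqdist z x.
Proof. by apply: sumr_ge0 => i _; exact: sqr_ge0. Qed.

Lemma norm_coord_le (R : realType) (d : nat) (x : 'rV[R]_d) (i : 'I_d) :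
  `|x ord0 i| <= `|x|.
Proof.
rewrite [leRHS]/Num.Def.normr/= mx_normrE.
by apply: le_trans; last exact: (le_bigmax _ _ (ord0, i)).
Qed.

(** Together with [norm_sqr_le_sqdist], this translates between the smooth Euclidean distance and
    the sup norm that gives the balls. *)
Lemma sqdist_le (R : realType) (d : nat) (z x : 'rV[R]_d) :
  sqdist z x <= d%:R * `|x - z| ^+ 2.
Proof.
have -> : d%:R * `|x - z| ^+ 2 = \sum_(i < d) `|x - z| ^+ 2.
  by rewrite sumr_const card_ord mulr_natl.
apply: ler_sum => i _.
rewrite -[leLHS]real_normK ?num_real// lerXn2r ?nnegrE//.
by have := norm_coord_le (x - z) i; rewrite !mxE.
Qed.

Lemma norm_sqr_le_sqdist (R : realType) (d : nat) (z x : 'rV[R]_d) :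
  `|x - z| ^+ 2 <= sqdist z x.
Proof.
have [->|] := eqVneq `|x - z| 0; first by rewrite expr0n sqdist_ge0.
(* A non-zero sup norm is attained at some coordinate, whose square is one of the summands of
   [sqdist]. *)
rewrite [X in X != 0 -> _]/Num.Def.normr/= => /mx_norm_neq0[[i j]].
rewrite [X in X ^+ _]/Num.Def.normr/= => ->; rewrite !mxE real_normK ?num_real//=.
rewrite (ord1 i) /sqdist (bigD1 j)//= lerDl; apply: sumr_ge0 => k _.
exact: sqr_ge0.
Qed.

Lemma sqdist_gt0 (R : realType) (d : nat) (z x : 'rV[R]_d) :
  x != z -> 0 < sqdist z x.
Proof.
move=> xz; apply: lt_le_trans (norm_sqr_le_sqdist z x).
by rewrite exprn_gt0// normr_gt0 subr_eq0.
Qed.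

Lemma subharmonic_sqdist (R : realType) (d : nat) (O : set 'rV[R]_d)
    (a b : R) (z : 'rV[R]_d) : (0 < d)%N -> 0 < a ->
  subharmonic O (fun x => (a * sqdist z x - b)%:E).
Proof.
move=> d0 a0.
apply: (@subharmonic_laplacian_gt0 _ _ _ _
    (fun i x => a * (2 * (x ord0 i - z ord0 i))) (fun i x => a * (2 * 1))).
- move=> x _; apply: continuousB; last exact: cst_continuous.
  by apply: continuousM; [exact: cst_continuous|exact: continuous_sqdist].
- move=> x i _; rewrite -[X in is_derive _ _ _ X]subr0; apply: is_deriveB.
  exact: (@is_deriveZ _ _ _ _ a _ _ _ (is_derive_sqdist z x i)).
- move=> x i _; have := is_derive_coordB z x i i; rewrite eqxx => D.
  exact: (is_deriveZ a (is_deriveZ 2 D)).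
- move=> x _; rewrite sumr_const card_ord pmulrn_lgt0//.
  by rewrite mulr_gt0// mulr_gt0.
Qed.

Lemma continuous_pole (R : realType) (d : nat) (a b : R) (z x : 'rV[R]_d) :
  x != z -> {for x, continuous (fun x => a * (sqdist z x)^-1 ^+ d - b)}.
Proof.
move=> xz; apply: continuousB; last exact: cst_continuous.
apply: continuousM; first exact: cst_continuous.
apply: (@continuous_comp _ _ _ (fun y : 'rV[R]_d => (sqdist z y)^-1)
  (fun r : R => r ^+ d)).
  apply: continuousV; last exact: continuous_sqdist.
  by rewrite gt_eqF// sqdist_gt0.
exact: exprn_continuous.
Qed.

(** Away from [z] the Laplacian of $|x-z|^{-2d}$ is $2d(d+2)|x-z|^{-2d-2}$. This exponent makes it
    strictly positive in every dimension, so that one formula serves all [d]. *)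
Lemma subharmonic_pole (R : realType) (d : nat) (O : set 'rV[R]_d)
    (a b : R) (z : 'rV[R]_d) : (0 < d)%N -> 0 < a -> ~ O z ->
  subharmonic O (fun x => (a * (sqdist z x)^-1 ^+ d - b)%:E).
Proof.
move=> d0 a0 Oz.
have q0 x : O x -> 0 < sqdist z x.
  by move=> Ox; apply: sqdist_gt0; apply: contra_not_neq Oz => <-.
(* The exponent is left free: [d] yields the first derivatives and [d.+1] the second ones. *)
have Dq n x i : O x -> is_derive x (delta_mx ord0 i)
    (fun y => (sqdist z y)^-1 ^+ n)
    (- n%:R * (sqdist z x)^-1 ^+ n.+1 * (2 * (x ord0 i - z ord0 i))).
  move=> /q0 q0x; have qn0 : sqdist z x != 0 by rewrite gt_eqF.
  have [dq dqE] := is_derive_sqdist z x i.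
  have DV : is_derive x (delta_mx ord0 i) (fun y => (sqdist z y)^-1)
      (- (sqdist z x) ^- 2 *: (2 * (x ord0 i - z ord0 i))).
    by split; [exact: derivableV|rewrite deriveV// dqE].
  have -> : (fun y => (sqdist z y)^-1 ^+ n) = (fun y => (sqdist z y)^-1) ^+ n.
    by rewrite exprfctE.
  refine (is_derive_eq (is_deriveX n DV) _).
  case: n => [|n]; first by rewrite !(mulr0n, mul0r, oppr0) scale0r.
  rewrite /= [LHS]mulrA; congr (_ * _).
  by rewrite -exprVn !exprS; ring.
apply: (@subharmonic_laplacian_gt0 _ _ _ _
    (fun i x => a * ((- d%:R * (sqdist z x)^-1 ^+ d.+1) *
      (2 * (x ord0 i - z ord0 i))))
    (fun i x => - (2 * a * d%:R) * ((sqdist z x)^-1 ^+ d.+1 -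
      2 * d.+1%:R * (sqdist z x)^-1 ^+ d.+2 * (x ord0 i - z ord0 i) ^+ 2))).
- move=> x Ox; apply: continuous_pole.
  by apply: contra_not_neq Oz => <-.
- move=> x i Ox; rewrite -[X in is_derive _ _ _ X]subr0; apply: is_deriveB.
  exact: (is_deriveZ a (Dq d x i Ox)).
- move=> x i Ox; have := is_derive_coordB z x i i; rewrite eqxx => D.
  have DM := is_deriveM (is_deriveZ (- d%:R) (Dq d.+1 x i Ox)) (is_deriveZ 2 D).
  refine (is_derive_eq (is_deriveZ a DM) _).
  by rewrite /= /GRing.scale/= !exprS; ring.
- move=> x /q0 q0x; rewrite -mulr_sumr sumrB sumr_const card_ord -mulr_sumr.
  rewrite -/(sqdist z x) -[X in X - _]mulr_natl.
  (* The squared coordinates add up to [sqdist z x], which cancels one inverse power. *)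
  have -> : 2 * d.+1%:R * (sqdist z x)^-1 ^+ d.+2 * sqdist z x =
      2 * d.+1%:R * (sqdist z x)^-1 ^+ d.+1.
    by rewrite [_ ^+ d.+2]exprSr -!mulrA mulVf ?mulr1// gt_eqF.
  have -> : forall p : R, - (2 * a * d%:R) * (d%:R * p - 2 * d.+1%:R * p) =
      2 * a * d%:R * (d%:R + 2) * p by move=> p; rewrite -natr1; ring.
  by rewrite !mulr_gt0 ?ltr0n// ?exprn_gt0 ?invr_gt0// addr_gt0// ltr0n.
Qed.

(** * Constants, multiples, maxima and gluing of subharmonic functions *)

Lemma near_eq_continuous (T U : topologicalType) (f g : T -> U) (x : T) :
  {near x, f =1 g} -> {for x, continuous f} -> {for x, continuous g}.
Proof.
move=> fg; rewrite /prop_for /continuous_at (nbhs_singleton fg) => fc.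
by apply: cvg_trans fc; exact: near_eq_cvg fg.
Qed.

Lemma harmonicZ (R : realType) (d : nat) (G : set 'rV[R]_d) (h : 'rV[R]_d -> R)
    (c : R) :
  open G -> harmonic G h -> harmonic G (fun x => c * h x).
Proof.
move=> oG [hC2 hlap].
have E i x : G x -> partial i (fun y => c * h y) x = c * partial i h x.
  by move=> Gx; have [_ /(_ i i)[hd _ _]] := hC2 _ Gx; exact: deriveZ.
(* The formula for first derivatives holds only on [G]; openness makes it hold near each point, as
   differentiating once more requires. *)
have nE i x : G x -> \near x, c * partial i h x = partial i (fun y => c * h y) x.
  move=> Gx; near=> y; rewrite E//; near: y; exact: open_nbhs_nbhs.
have EE i j x : G x -> partial j (partial i (fun y => c * h y)) x =
    c * partial j (partial i h) x.
  move=> Gx; rewrite {1}/partial -(near_eq_derive _ (nE i x Gx)).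
  by have [_ /(_ i j)[_ hd _]] := hC2 _ Gx; exact: deriveZ.
split=> x Gx; last first.
  under eq_bigr do rewrite EE//.
  by rewrite -mulr_sumr hlap// mulr0.
have [hc hd] := hC2 _ Gx; split=> [|i j].
  by apply: continuousM; [exact: cst_continuous|exact: hc].
have [d1 d2 c2] := hd i j; split.
- exact: derivableZ.
- by apply: near_eq_derivable (nE i x Gx) _; exact: derivableZ.
- apply: (@near_eq_continuous _ _ (fun y => c * partial j (partial i h) y)).
    by near=> y; apply/esym/EE; near: y; exact: open_nbhs_nbhs.
  by apply: continuousM; [exact: cst_continuous|exact: c2].
Unshelve. all: by end_near. Qed.

Lemma subharmonic_ninfty (R : realType) (d : nat) (O : set 'rV[R]_d) :
  subharmonic O (fun _ => -oo%E).
Proof.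
split=> [x _|x _ a _|G h _ _ _ _ _ _ x _]; rewrite ?ltNyr ?leNye//.
exact: filterE.
Qed.

(** A constant has Laplacian 0, so the strict criterion is applied after adding a small multiple of
    [sqdist 0]; the error [e] is arbitrary. *)
Lemma subharmonic_cst (R : realType) (d : nat) (O : set 'rV[R]_d) (c : R) :
  (0 < d)%N -> subharmonic O (fun _ => c%:E).
Proof.
move=> d0; split.
- by move=> x _; rewrite ltry.
- by move=> x _ a ca; exact: filterE.
move=> G h oG cG GO hc hh ch x Gx; rewrite lee_fin.
have [m mM] : exists m : R, forall y, closure G y -> sqdist 0 y <= m.
  have [y _ my] : exists2 c, c \in closure G &
    forall t, t \in closure G -> sqdist 0 t <= sqdist 0 c.
    apply: EVT_max_rV => //; first by exists x; exact: subset_closure.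
    exact/continuous_subspaceT/continuous_sqdist.
  by exists (sqdist 0 y) => t Gt; apply: my; rewrite inE.
have m0 : 0 <= m := le_trans (sqdist_ge0 0 x) (mM _ (subset_closure Gx)).
apply/ler_addgt0Pr => e e0.
(* The perturbed function stays below [c] on [closure G] and loses at most [a * m <= e] at [x]; the
   summand 1 keeps the denominator positive when [m] is 0. *)
pose a := e / (m + 1).
have a0 : 0 < a by rewrite divr_gt0// ltr_wpDl.
have [_ _ H] := subharmonic_sqdist O (a * m - c) 0 d0 a0.
have := H G h oG cG GO hc hh _ x Gx; rewrite lee_fin => /(_ _).
have am : a * m <= e.
  by rewrite /a mulrAC ler_pdivrMr ?ltr_wpDl// ler_pM2l// lerDl.
have aq : 0 <= a * sqdist 0 x by rewrite mulr_ge0 ?sqdist_ge0// ltW.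
suff W : forall y, (closure G `\` G) y ->
    ((a * sqdist 0 y - (a * m - c))%:E <= (h y)%:E)%E.
  move=> /(_ W); lra.
move=> y Gy; apply: le_trans (ch _ Gy); rewrite lee_fin.
have : a * sqdist 0 y <= a * m by rewrite ler_pM2l// mM//; case: Gy.
lra.
Qed.

Lemma subharmonic_scale (R : realType) (d : nat) (O : set 'rV[R]_d)
    (c : R) (s : 'rV[R]_d -> R) : 0 < c ->
  subharmonic O (fun x => (s x)%:E) -> subharmonic O (fun x => (c * s x)%:E).
Proof.
move=> c0 [_ usc sle]; split; first by move=> x _; rewrite ltry.
- move=> x Ox a; rewrite lte_fin -ltr_pdivlMl// => sa.
  have := usc x Ox _ sa; apply: filterS => y.
  by rewrite !lte_fin ltr_pdivlMl.
- move=> G h oG cG GO hc hh sh x Gx; rewrite lee_fin -ler_pdivlMl// -lee_fin.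
  apply: (sle G (fun y => c^-1 * h y)) => //.
  + by move=> y; apply: cvgMl_tmp; exact: hc.
  + exact: harmonicZ.
  + by move=> y Gy; have := sh y Gy; rewrite !lee_fin ler_pdivlMl.
Qed.

Lemma subharmonic_max (R : realType) (d : nat) (O : set 'rV[R]_d)
    (u v : 'rV[R]_d -> \bar R) :
  subharmonic O u -> subharmonic O v ->
  subharmonic O (fun x => maxe (u x) (v x)).
Proof.
move=> [uoo uusc ule] [voo vusc vle]; split.
- by move=> x Ox; rewrite gt_max uoo// voo.
- move=> x Ox a; rewrite gt_max => /andP[ua va].
  by near=> y; rewrite gt_max; apply/andP; split; near: y;
    [exact: uusc|exact: vusc].
- move=> G h oG cG GO hc hh uvh x Gx; rewrite ge_max; apply/andP; split.
  + apply: ule Gx => // y /uvh; rewrite ge_max => /andP[]//.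
  + apply: vle Gx => // y /uvh; rewrite ge_max => /andP[]//.
Unshelve. all: by end_near. Qed.

(* Riesz's definition makes gluing immediate: [s] lies below [h] on all of
   [G], in particular on the part of the boundary of [V] inside [G]. *)
Lemma subharmonic_glue (R : realType) (d : nat) (O W V : set 'rV[R]_d)
    (u s : 'rV[R]_d -> \bar R) :
  open V -> closure V `&` O `<=` W ->
  subharmonic W u -> subharmonic O s ->
  (forall x, O x -> (closure V `\` V) x -> (u x <= s x)%E) ->
  subharmonic O (fun x => if x \in V then maxe (u x) (s x) else s x).
Proof.
move=> oV VW [uoo uusc ule] [soo susc sle] us; split.
- move=> x Ox; case: ifPn => [/[!inE] Vx|_]; last exact: soo.
  by rewrite gt_max soo// uoo//; apply: VW; split => //; exact: subset_closure.
- move=> x Ox a.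
  have [cVx|ncVx] := pselect (closure V x).
    (* On the boundary of [V] only [s] is visible in the value at [x], but [u <= s] there, so both
       functions are below [a]. *)
    have Wx : W x by exact: VW.
    move=> H; have [ua sa] : (u x < a%:E)%E /\ (s x < a%:E)%E.
      move: H; case: ifPn => [_|]; first by rewrite gt_max => /andP[].
      rewrite notin_setE => nVx sa; split => //.
      by apply: le_lt_trans sa; exact: us.
    near=> y; case: ifPn => _; last by near: y; exact: susc.
    by rewrite gt_max; apply/andP; split; near: y; [exact: uusc|exact: susc].
  rewrite memNset => [sa|]; last by move=> /subset_closure.
  near=> y; rewrite memNset; first by near: y; exact: susc.
  move=> /subset_closure; near: y; apply: open_nbhs_nbhs; split => //.
  exact/closed_openC/closed_closure.
move=> G h oG cG GO hc hh bh x Gx.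
have sh y : G y -> (s y <= (h y)%:E)%E.
  apply: (sle G h) => // z /bh; case: ifPn => // _.
  by rewrite ge_max => /andP[].
have clGV : closure (G `&` V) `<=` closure G `&` closure V by exact: closureI.
have clGG : G `<=` closure G by exact: subset_closure.
case: ifPn => [/[!inE] Vx|_]; last exact: sh.
rewrite ge_max sh// andbT.
apply: (ule (G `&` V) h) => //.
- exact: openI.
- apply: (subclosed_compact _ cG); first exact: closed_closure.
  by move=> y /clGV[].
- by move=> y /clGV[cGy cVy]; apply: VW; split => //; exact: GO.
- by apply: continuous_subspaceW hc => y /clGV[].
- by case: hh => C2 lap; split=> [y [/C2]|y [/lap]].
(* A boundary point of [G] intersected with [V] lies either in [G] and on the boundary of [V], where
   [u <= s <= h], or on the boundary of [G], where the assumed bound applies. *)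
- move=> y [/clGV[cGy cVy]]; have Oy := GO _ cGy.
  have [Gy nGVy|nGy _] := pselect (G y).
    by apply: le_trans (sh _ Gy); apply: us => //; split => // Vy; exact: nGVy.
  have := bh y (conj cGy nGy).
  case: ifPn => [_|]; first by rewrite ge_max => /andP[].
  by rewrite notin_setE => nVy; apply: le_trans; exact: us.
Unshelve. all: by end_near. Qed.

(** * Barriers *)

(** The bound -1, rather than 0, lets a large multiple sink below any prescribed level on [K]. *)
Definition barrier (R : realType) (d : nat) (O K : set 'rV[R]_d)
    (s : 'rV[R]_d -> R) : Prop :=
  [/\ subharmonic O (fun x => (s x)%:E),
      forall x, O x -> {for x, continuous s} &
      forall x, K x -> s x <= -1].

Definition separated_from (R : realType) (d : nat) (O K : set 'rV[R]_d)
    (z : 'rV[R]_d) : Prop :=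
  exists2 s, barrier O K s & 0 < s z.

Lemma barrier_scale (R : realType) (d : nat) (O K : set 'rV[R]_d)
    (c : R) (s : 'rV[R]_d -> R) :
  1 <= c -> barrier O K s -> barrier O K (fun x => c * s x).
Proof.
move=> c1 [sO sc sK]; split.
- by apply: subharmonic_scale => //; exact: lt_le_trans c1.
- by move=> x Ox; apply: continuousM; [exact: cst_continuous|exact: sc].
- by move=> x /sK; nra.
Qed.

Lemma barrier_max (R : realType) (d : nat) (O K : set 'rV[R]_d)
    (s t : 'rV[R]_d -> R) :
  barrier O K s -> barrier O K t ->
  barrier O K (fun x => Num.max (s x) (t x)).
Proof.
move=> [sO sc sK] [tO tc tK]; split.
- by under eq_fun do rewrite EFin_max; exact: subharmonic_max.
- by move=> x Ox; apply: continuous_max; [exact: sc|exact: tc].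
- by move=> x Kx; rewrite ge_max sK// tK.
Qed.

(** Turns a strict gap between the value at a point and the values on [K] into the normalisation of
    barriers; as [a] is positive, subharmonicity survives. *)
Lemma affine_separation (R : realFieldType) (p t : R) : t < p ->
  exists a b : R, [/\ 0 < a, a * p - b = 1 & a * t - b = -1].
Proof.
move=> tp; exists (2 / (p - t)), ((p + t) / (p - t)).
have pt0 : p - t != 0 by rewrite subr_eq0 gt_eqF.
split; [by rewrite divr_gt0// subr_gt0|field|field] => //.
Qed.

Lemma pole_separation (R : realType) (d : nat) (K : set 'rV[R]_d)
    (z z' : 'rV[R]_d) (r : R) : (0 < d)%N ->
  z' != z -> sqdist z z' < r -> (forall k, K k -> r <= sqdist z k) ->
  exists a b : R, [/\ 0 < a, 0 < a * (sqdist z z')^-1 ^+ d - b &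
    forall k, K k -> a * (sqdist z k)^-1 ^+ d - b <= -1].
Proof.
move=> d0 zz' qr Kr; have q0 := sqdist_gt0 zz'; have r0 := lt_trans q0 qr.
have inv2 : r^-1 ^+ d < (sqdist z z')^-1 ^+ d.
  by rewrite ltrXn2r ?nnegrE ?invr_ge0 ?ltf_pV2 ?posrE ?ltW// -lt0n.
have [a [b [a0 p1 m1]]] := affine_separation inv2.
exists a, b; split => //; first by rewrite p1.
move=> k /Kr rk; rewrite -m1 lerB// ler_pM2l//.
have qk0 := lt_le_trans r0 rk.
by rewrite lerXn2r ?nnegrE ?invr_ge0 ?lef_pV2 ?posrE// ltW.
Qed.

Lemma separated_from_pole (R : realType) (d : nat) (O K : set 'rV[R]_d)
    (z z' : 'rV[R]_d) (r : R) : (0 < d)%N -> ~ O z -> z' != z ->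
  sqdist z z' < r -> (forall k, K k -> r <= sqdist z k) ->
  separated_from O K z'.
Proof.
move=> d0 Oz zz' qr Kr.
have [a [b [a0 Fz' FK]]] := pole_separation d0 zz' qr Kr.
exists (fun x => a * (sqdist z x)^-1 ^+ d - b) => //; split => //.
- exact: subharmonic_pole.
- move=> x Ox; apply: continuous_pole.
  by apply: contra_not_neq Oz => <-.
Qed.

Lemma separated_from_infty (R : realType) (d : nat) (O K : set 'rV[R]_d)
    (z' : 'rV[R]_d) (r : R) : (0 < d)%N ->
  r < sqdist 0 z' -> (forall k, K k -> sqdist 0 k <= r) ->
  separated_from O K z'.
Proof.
move=> d0 qr Kr; have [a [b [a0 p1 m1]]] := affine_separation qr.
exists (fun x => a * sqdist 0 x - b); last by rewrite p1.
split.
- exact: subharmonic_sqdist.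
- move=> x _; apply: continuousB; last exact: cst_continuous.
  by apply: continuousM; [exact: cst_continuous|exact: continuous_sqdist].
- by move=> k /Kr kr; rewrite -m1 lerB// ler_pM2l.
Qed.

(** Wherever [u] takes over from [s] near [x], it is squeezed: [u y] exceeds [s y], which is near
    [s x], and stays below [u x + e <= s x + e]. *)
Lemma continuous_glue (R : realType) (T : topologicalType) (V : set T)
    (u s : T -> R) (x : T) :
  {for x, continuous u} -> {for x, continuous s} -> u x <= s x -> ~ V x ->
  {for x, continuous (fun y => if y \in V then Num.max (u y) (s y) else s y)}.
Proof.
move=> uc sc us nVx; rewrite /prop_for /continuous_at memNset//.
apply/cvgrPdist_lt => e e0; near=> y.
have sy : `|s x - s y| < e by near: y; exact: (cvgr_dist_lt _ _ sc).
have uy : `|u x - u y| < e by near: y; exact: (cvgr_dist_lt _ _ uc).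
case: ifPn => // _; case: (leP (u y) (s y)) => // su.
move: sy uy; rewrite !ltr_norml; lra.
Unshelve. all: by end_near. Qed.

(* The pole of [F] at [z] is cut off by a multiple of the given function that
   is positive there; this moves the point of positivity from [z] to [z']. *)
Lemma separated_from_push (R : realType) (d : nat) (O K : set 'rV[R]_d)
    (z z' : 'rV[R]_d) (r : R) : (0 < d)%N -> open O -> O z ->
  sqdist z z' < r -> (forall k, K k -> r <= sqdist z k) ->
  separated_from O K z -> separated_from O K z'.
Proof.
move=> d0 oO Oz qr Kr [s bs sz].
have [->|zz'] := eqVneq z' z; first by exists s.
have [a [b [a0 Fz' FK]]] := pole_separation d0 zz' qr Kr.
pose F x := a * (sqdist z x)^-1 ^+ d - b.
have [bsO sc sK] := bs.
have [e e0 He] : exists2 e, 0 < e &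
    forall x, sqdist z x <= e -> O x /\ s z / 2 < s x.
  have : \forall x \near z, O x /\ s z / 2 < s x.
    near=> x; split; near: x; first exact: open_nbhs_nbhs.
    by apply: (cvgr_gt (s z)); [exact: sc|rewrite ltr_pdivrMr//; lra].
  (* The new [e] bounds a squared distance; halving turns the weak inequality into membership in the
     open ball. *)
  move=> /nbhs_ballP[e /= e0 He]; exists ((e / 2) ^+ 2).
    by rewrite exprn_gt0// divr_gt0.
  move=> x qx; apply: He; rewrite -ball_normE /ball_/= distrC.
  have : `|x - z| ^+ 2 <= (e / 2) ^+ 2.
    exact: le_trans (norm_sqr_le_sqdist _ _) qx.
  rewrite ler_pXn2r ?nnegrE ?divr_ge0 ?(ltW e0)//. move=> xz.
  by apply: le_lt_trans xz _; rewrite ltr_pdivrMr// ltr_pMr// ltr1n.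
(* [M] is the value of [F] on the sphere [sqdist z x = e]. As [s] exceeds [s z / 2] on the closed
   ball, the factor [N] lifts [N * s] to at least [M] there. *)
pose M := a * e^-1 ^+ d - b.
pose N := Num.max 1 (2 * M / s z).
have N1 : 1 <= N by rewrite le_max lexx.
have NM x : sqdist z x <= e -> M <= N * s x.
  move=> /He[_ sx]; have : 2 * M / s z <= N by rewrite le_max lexx orbT.
  by rewrite ler_pdivrMr//; nra.
pose V := [set x | e < sqdist z x].
have oV : open V.
  apply: (@open_comp _ _ (sqdist z) [set y | e < y]); last exact: open_gt.
  by move=> x _; exact: continuous_sqdist.
have cVE x : closure V x -> e <= sqdist z x.
  have : closed [set x | e <= sqdist z x].
    apply: (@closed_comp _ _ (sqdist z) [set y | e <= y]); last exact: closed_ge.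
    by move=> y _; exact: continuous_sqdist.
  by move=> cl cVx; apply: cl; apply: closureS cVx => y; exact: ltW.
have [tO tc tK] := barrier_scale N1 bs.
pose t x := if x \in V then Num.max (F x) (N * s x) else N * s x.
exists t; last first.
  rewrite /t; case: ifPn; first by rewrite lt_max Fz'.
  rewrite notin_setE => /negP; rewrite -leNgt => /He[_ sz'].
  by rewrite mulr_gt0//; [exact: lt_le_trans N1|lra].
split.
(* [F] is subharmonic off its pole, and [closure V] avoids the pole. *)
- have Wz : ~ (~` [set z]) z by move=> /(_ erefl).
  have := @subharmonic_glue _ _ O (~` [set z]) V (fun x => (F x)%:E)
    (fun x => (N * s x)%:E) oV _ (subharmonic_pole b d0 a0 Wz) tO _.
  have tE : (fun x => (t x)%:E) = (fun x =>
      if x \in V then maxe (F x)%:E (N * s x)%:E else (N * s x)%:E).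
    by apply/funext => x; rewrite /t; case: ifPn; rewrite ?EFin_max.
  rewrite tE; apply.
  + move=> x [/cVE ex _] xz; move: ex; rewrite xz leNgt.
    by rewrite (_ : sqdist z z = 0) ?e0// /sqdist big1// => i _; rewrite subrr expr0n.
  + move=> x Ox [/cVE ex /negP]; rewrite -leNgt => xe; rewrite lee_fin.
    have qe : sqdist z x = e by apply/le_anti; rewrite ex xe.
    by apply: le_trans (NM _ xe); rewrite /F qe.
- move=> x Ox.
  (* Outside the closed ball [t] is a maximum of continuous functions, inside the open ball it is
     [N * s], and on the sphere [continuous_glue] applies. *)
  have [ex|xe] := ltP e (sqdist z x).
    have xz : x != z.
      apply: contraTneq ex => ->; rewrite -leNgt /sqdist big1 ?ltW// => i _.
      by rewrite subrr expr0n.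
    apply: (@near_eq_continuous _ _ (fun y => Num.max (F y) (N * s y))).
      by near=> y; rewrite /t mem_set//; near: y; exact: open_nbhs_nbhs.
    by apply: continuous_max; [exact: continuous_pole|exact: tc].
  have nVx : ~ V x by apply/negP; rewrite -leNgt.
  have [{}xe|ex] := ltP (sqdist z x) e.
    apply: near_eq_continuous (tc _ Ox); near=> y; rewrite /t memNset//.
    apply/negP; rewrite -leNgt ltW//; near: y.
    by apply: (cvgr_lt (sqdist z x)); [exact: continuous_sqdist|].
  apply: continuous_glue => //; last 2 first.
  + exact: tc.
  + have qe : sqdist z x = e by apply/le_anti; rewrite ex xe.
    by apply: le_trans (NM _ xe); rewrite /F qe.
  + apply: continuous_pole; apply: contraTneq ex => ->.
    rewrite -ltNge /sqdist big1 ?e0// => i _; by rewrite subrr expr0n.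
- move=> k Kk; rewrite /t; case: ifPn => _; last exact: tK.
  by rewrite ge_max FK// tK.
Unshelve. all: by end_near. Qed.

(** * Components and the hull *)

(** A ball is the union of the segments from its centre to its points. *)
Lemma connected_ball (R : realType) (V : normedModType R) (x : V) (e : R) :
  connected (ball x e).
Proof.
have [e0|e0] := leP e 0; first by rewrite le0_ball0//; exact: connected0.
pose f (y : V) (t : R) := x + t *: (y - x).
have -> : ball x e = \bigcup_(y in ball x e) (f y @` `[0, 1]).
  apply/seteqP; split => [y xy|_ [y xy] [t t01 <-]].
    exists y => //; exists 1; first by rewrite /= in_itv/= ler01 lexx.
    by rewrite /f scale1r addrC subrK.
  move: t01; rewrite /= in_itv/= => /andP[t0 t1].
  move: xy; rewrite -ball_normE /ball_/= /f opprD addrA subrr sub0r normrN normrZ.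
  by rewrite ger0_norm// distrC; apply: le_lt_trans; rewrite ler_piMl.
apply: bigcup_connected.
  exists x => y xy; exists 0; first by rewrite /= in_itv/= ler01 lexx.
  by rewrite /f scale0r addr0.
move=> y _; apply: connected_continuous_connected; first exact: segment_connected.
apply: continuous_subspaceT => t; rewrite /f; apply: cvgD; first exact: cvg_cst.
exact: scalel_continuous.
Qed.

Lemma open_connected_component (R : realType) (V : normedModType R)
    (A : set V) (x : V) : open A -> open (connected_component A x).
Proof.
move=> oA; rewrite openE => y Cy; have Ay := connected_component_sub Cy.
have [e /= e0 eA] : nbhs_ball y A by apply/nbhs_ballP; exact: open_nbhs_nbhs.
apply/nbhs_ballP; exists e => //= z yz.
rewrite (same_connected_component Cy); exists (ball y e) => //.
by split => //; [exact: ballxx|exact: connected_ball].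
Qed.

(** The component of a limit point [y] in [A] is an open neighbourhood of [y], hence meets the given
    component and coincides with it. *)
Lemma closure_component_sub (R : realType) (V : normedModType R)
    (A : set V) (x : V) :
  open A -> closure (connected_component A x) `&` A `<=` connected_component A x.
Proof.
move=> oA y [cy Ay].
have [z [xz yz]] : (connected_component A x `&` connected_component A y) !=set0.
  apply: cy; apply: open_nbhs_nbhs; split; first exact: open_connected_component.
  exact: connected_component_refl.
by apply: (connected_component_trans xz); exact: connected_component_sym.
Qed.

Lemma open_ball_disjoint (R : realType) (V : normedModType R) (A : set V)
    (x : V) : open A -> A x ->
  exists2 e : R, 0 < e & forall y, ~ A y -> e <= `|x - y|.
Proof.
move=> oA Ax; have /nbhs_ballP[e /= e0 eA] := open_nbhs_nbhs (conj oA Ax).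
exists e => // y nAy; rewrite leNgt; apply/negP => xy; apply: nAy.
by apply: eA; rewrite -ball_normE.
Qed.

Lemma closure_norm_lt (R : realType) (V : normedModType R) (A : set V)
    (x : V) (e : R) :
  closure A x -> 0 < e -> exists2 y, A y & `|x - y| < e.
Proof.
move=> cx e0; have [y [Ay]] := cx _ (nbhsx_ballx x e e0).
by rewrite -ball_normE => xy; exists y.
Qed.

Lemma compact_closure_bounded (R : realType) (d : nat) (A : set 'rV[R]_d)
    (M : R) : (forall x, A x -> `|x| <= M) -> compact (closure A).
Proof.
move=> AM; apply: bounded_closed_compact; last exact: closed_closure.
exists M; split => [|r Mr x cAx]; first exact: num_real.
apply: le_trans (ltW Mr).
have : closed_ball_ (fun y : 'rV[R]_d => `|y|) 0 M x.
  apply: (@closed_closed_ball_ _ _ 0 M); apply: closureS cAx => y /AM.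
  by rewrite /closed_ball_/= sub0r normrN.
by rewrite /closed_ball_/= sub0r normrN.
Qed.

(** Prepares [pole_separation] with [r = (e / 2) ^+ 2]: the pole [z] is so close to [z'] that [K] is
    farther from it. The factor [d] in the radius pays for passing from the sup norm to the
    Euclidean one. *)
Lemma sqdist_near (R : realType) (d : nat) (K : set 'rV[R]_d)
    (z z' : 'rV[R]_d) (e : R) : (0 < d)%N -> 0 < e ->
  `|z' - z| < e / (4 * d%:R) -> (forall k, K k -> e <= `|z' - k|) ->
  sqdist z z' < (e / 2) ^+ 2 /\ (forall k, K k -> (e / 2) ^+ 2 <= sqdist z k).
Proof.
move=> d0 e0 zz' Ke.
have d1 : 1 <= d%:R :> R by rewrite ler1n.
move: zz'; rewrite ltr_pdivlMr ?mulr_gt0 ?ltr0n// => zz'.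
have n0 := normr_ge0 (z' - z).
split.
  apply: le_lt_trans (sqdist_le z z') _.
  set n := `|z' - z| in zz' n0 *; set p := d%:R * n.
  have np : n <= p by rewrite /p ler_peMl.
  have -> : d%:R * n ^+ 2 = p * n by rewrite /p; ring.
  have p4 : p * 4 < e by rewrite /p; lra.
  by nra.
move=> k Kk; apply: le_trans (norm_sqr_le_sqdist z k).
have : e / 2 <= `|k - z|.
  have := Ke _ Kk; have := ler_distD z z' k; rewrite (distrC z k); nra.
by rewrite ler_pXn2r ?nnegrE// divr_ge0// ltW.
Qed.

(** * Separation of the points outside the hull from [K] *)

Section separation.
Context {R : realType} {d : nat}.
Variables (O K : set 'rV[R]_d).
Hypotheses (d0 : (0 < d)%N) (oO : open O) (cK : compact K) (KO : K `<=` O).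

Let closedK : closed K.
Proof. by apply: compact_closed cK; exact: norm_hausdorff. Qed.

Let oOK : open (O `\` K).
Proof. by rewrite setDE; apply: openI => //; exact: closed_openC. Qed.

(** In the connected set [C] the separated points form an open subset, as barriers are continuous,
    and a relatively closed one, as positivity can be pushed over a short distance. *)
Lemma separated_from_component (x y : 'rV[R]_d) :
  connected_component (O `\` K) x y -> separated_from O K y ->
  separated_from O K x.
Proof.
set C := connected_component _ x => Cy sy.
have CO z : C z -> O z /\ ~ K z by move=> /connected_component_sub[].
suff CE : C `&` [set z | separated_from O K z] = C.
  have Cx : C x.
    exact: connected_component_trans Cy (connected_component_sym Cy).
  by move: Cx; rewrite -CE => -[].
apply: (@component_connected _ (O `\` K) x).
- by exists y.
- exists [set z | O z /\ separated_from O K z].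
    rewrite openE => z [Oz [s bs sz]]; have [_ sc _] := bs.
    near=> w; split; first by near: w; exact: open_nbhs_nbhs.
    by exists s => //; near: w; apply: (cvgr_gt (s z)) => //; exact: sc.
  apply/seteqP; split=> z [Cz] => [sz|[_ sz]]; split=> //.
  by split=> //; case: (CO _ Cz).
- exists (closure (C `&` [set z | separated_from O K z])).
    exact: closed_closure.
  apply/seteqP; split=> [z [Cz sz]|z [Cz cz]].
    by split=> //; apply: subset_closure; split.
  split=> //=.
  (* [K] stays at distance at least [e] from [z], while separated points [w] come arbitrarily close
     to [z]; such a [w] serves as the pole. *)
  have [e e0 He] := open_ball_disjoint oOK (connected_component_sub Cz).
  have e40 : 0 < e / (4 * d%:R) by rewrite divr_gt0// mulr_gt0// ltr0n.
  have [w [Cw sw] zw] := closure_norm_lt cz e40.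
  have [|H1 H2] := @sqdist_near _ _ K w z e d0 e0 zw.
    by move=> k Kk; apply: He => -[].
  exact: (separated_from_push d0 oO (proj1 (CO _ Cw)) H1 H2 sw).
Unshelve. all: by end_near. Qed.

Lemma separated_from_hull (x : 'rV[R]_d) :
  O x -> ~ hull_in O K x -> separated_from O K x.
Proof.
move=> Ox /not_orP[nKx nC].
have OKx : (O `\` K) x by [].
set C := connected_component (O `\` K) x in nC.
have CO z : C z -> O z /\ ~ K z by move=> /connected_component_sub[].
suff [y Cy sy] : exists2 y, C y & separated_from O K y.
  exact: separated_from_component sy.
(* A limit point of [C] outside [O] can carry a pole; it lies off [K], and [C] contains points much
   closer to it than [K] is. *)
have [[y cCy nOy]|cCO] := pselect (exists2 y, closure C y & ~ O y).
  have [|e e0 He] := @open_ball_disjoint _ _ (~` K) y (closed_openC closedK).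
    by move=> /KO.
  have e20 : 0 < e / 2 by rewrite divr_gt0.
  have e40 : 0 < e / 2 / (4 * d%:R) by rewrite divr_gt0// mulr_gt0// ltr0n.
  have [z Cz] := closure_norm_lt cCy e40.
  rewrite distrC => yz; exists z => //.
  have [|H1 H2] := @sqdist_near _ _ K y z (e / 2) d0 e20 yz.
    move=> k Kk; have /He : ~ (~` K) k by [].
    have := ler_distD z y k; move: yz; rewrite (distrC y z).
    rewrite ltr_pdivlMr ?mulr_gt0 ?ltr0n// => yz.
    have d1 : 1 <= d%:R :> R by rewrite ler1n.
    have := normr_ge0 (z - y); nra.
  apply: (separated_from_pole d0 nOy _ H1 H2).
  by apply: contra_not_neq nOy => <-; case: (CO _ Cz).
have {}cCO : closure C `<=` O.
  by move=> z cz; apply: contrapT => nOz; apply: cCO; exists z.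
have [m mK] : exists m : R, forall k, K k -> sqdist 0 k <= m.
  have [->|/set0P K0] := eqVneq K set0; first by exists 0.
  have [y _ my] : exists2 c, c \in K &
    forall t, t \in K -> sqdist 0 t <= sqdist 0 c.
    by apply: EVT_max_rV => //; exact/continuous_subspaceT/continuous_sqdist.
  by exists (sqdist 0 y) => t Kt; apply: my; rewrite inE.
(* If no point of [C] were separated, [C] would be bounded by [Num.max 1 m]: a norm above both 1 and
   [m] has square above [m], and [sqdist 0] then yields a barrier. *)
apply: contrapT => nsC; apply: nC; split=> //.
rewrite setIidl//; apply: (@compact_closure_bounded _ _ _ (Num.max 1 m)).
move=> z Cz; rewrite leNgt gt_max; apply/negP => /andP[z1 zm]; apply: nsC.
exists z => //; have mz : m < sqdist 0 z.
  by have := norm_sqr_le_sqdist 0 z; rewrite subr0; nra.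
exact: separated_from_infty d0 mz mK.
Qed.

End separation.

(** Compactness gives one radius [e] for which all balls centred in [K] stay in [W]; balls of radius
    [e / 2] leave room for the closure. *)
Lemma compact_neighborhood (R : realType) (d : nat) (K W : set 'rV[R]_d) :
  compact K -> open W -> K `<=` W ->
  exists V : set 'rV[R]_d,
    [/\ open V, K `<=` V, compact (closure V) & closure V `<=` W].
Proof.
move=> cK oW KW.
have [e [e0 He]] : exists e : R, 0 < e /\ forall x, K x -> ball x e `<=` W.
  have : \forall e \near (0 : R)^'+, K `<=` (fun x => ball x e `<=` W).
    apply: (proj1 (compact_near_coveringP K) cK) => x /KW Wx.
    have /nbhs_ballP[r /= r0 rW] := open_nbhs_nbhs (conj oW Wx).
    have r20 : 0 < r / 2 by rewrite divr_gt0.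
    near=> y e.
    have er : e <= r / 2 by near: e; exact: nbhs_right_le.
    have xy : ball x (r / 2) y by near: y; exact: nbhsx_ballx.
    move=> z yz; apply: rW; rewrite (splitr r); apply: (ball_triangle xy).
    exact: le_ball yz.
  move=> H; near (0 : R)^'+ => e; exists e; split; first by [].
  by near: e.
have e20 : 0 < e / 2 by rewrite divr_gt0.
exists (\bigcup_(x in K) ball x (e / 2)); split.
- by apply: bigcup_open => x _; exact: ball_open.
- by move=> x Kx; exists x => //; exact: ballxx.
- have [M [_ KM]] := compact_bounded cK.
  apply: (@compact_closure_bounded _ _ _ (M + 1 + e / 2)) => y [x Kx].
  rewrite -ball_normE /ball_/= => xy.
  have : `|x| <= M + 1 by apply: (KM (M + 1)) => //; rewrite ltrDl.
  have := ler_distD x y 0; rewrite !subr0 (distrC y); lra.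
- move=> y /closure_norm_lt/(_ e20)[v [x Kx xv] yv].
  apply: (He x Kx); rewrite (splitr e); apply: (ball_triangle xv).
  by rewrite -ball_normE /ball_/= distrC.
Unshelve. all: by end_near. Qed.

(** Finite subcovers in the form of a sequence of centres, suited to induction and to finite
    unions. *)
Lemma compact_pointwise_cover (T : ptopologicalType) (A : set T)
    (f : T -> set T) : compact A ->
  (forall x, A x -> open (f x) /\ f x x) ->
  exists s : seq T, (forall z, z \in s -> A z) /\
    forall x, A x -> exists2 z, z \in s & f z x.
Proof.
rewrite compact_cover => cA fA.
have [||D' D'A AD'] := cA T A f.
- by move=> x /fA[].
- by move=> x Ax; exists x => //; case: (fA _ Ax).
exists (finmap.enum_fset D'); split; first by move=> z /D'A; rewrite inE.
by move=> x /AD'[z zD' fzx]; exists z.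
Qed.

(** A coordinate would attain its maximum on [C], while openness leaves room to increase it. *)
Lemma open_not_compact (R : realType) (d : nat) (C : set 'rV[R]_d) :
  (0 < d)%N -> open C -> C !=set0 -> ~ compact C.
Proof.
move=> d0 oC C0 cC; pose i := Ordinal d0.
have [c /[!inE] Cc cmax] : exists2 c : 'rV[R]_d, c \in C &
    forall t : 'rV[R]_d, t \in C -> t ord0 i <= c ord0 i.
  apply: EVT_max_rV => //; apply: continuous_subspaceT => x.
  exact: coord_continuous.
have /nbhs_ballP[e /= e0 eC] := open_nbhs_nbhs (conj oC Cc).
have /eC Ct : ball c e (c + const_mx (e / 2)).
  rewrite -ball_normE /ball_/= opprD addrA subrr sub0r normrN.
  rewrite [ltLHS]/Num.Def.normr/= mx_normrE; apply: bigmax_lt => //= ij _.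
  by rewrite mxE ger0_norm ?divr_ge0 ?(ltW e0)// ltr_pdivrMr// ltr_pMr// ltr1n.
have := cmax _ (mem_set Ct); rewrite !mxE leNgt ltrDl => /negP; apply.
by rewrite divr_gt0.
Qed.

(** * Compactness of the inward-filled hull *)

Section hull.
Context {R : realType} {d : nat}.
Variables (O K : set 'rV[R]_d).
Hypotheses (d0 : (0 < d)%N) (oO : open O) (cK : compact K) (KO : K `<=` O).

Let closedK : closed K.
Proof. by apply: compact_closed cK; exact: norm_hausdorff. Qed.

Let oOK : open (O `\` K).
Proof. by rewrite setDE; apply: openI => //; exact: closed_openC. Qed.

Local Notation comp := (connected_component (O `\` K)).

Lemma hull_in_sub : hull_in O K `<=` O.
Proof. by move=> x [/KO//|[[]]]. Qed.

(** The compact set on the left of the arrow is closed and contains [C], hence contains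
    [closure C]. *)
Lemma closure_sub_compactI (C : set 'rV[R]_d) :
  C `<=` O -> compact (closure C `&` O) -> closure C `<=` O.
Proof.
move=> CO /compact_closed -/(_ (@norm_hausdorff _ _)) cCO.
suff : closure C `<=` closure C `&` O by move=> H x /H[].
by move=> x cx; apply: cCO; apply: closureS cx => y Cy; split;
  [exact: subset_closure|exact: CO].
Qed.

(** A relatively compact component that leaves [closure V] must cross the compact set [Z], and
    finitely many components cover [Z]. So the hull lies in a compact set [T], from which it is cut
    out by removing an open set [N]. *)
Lemma compact_hull_in : compact (hull_in O K).
Proof.
have [V [oV KV cV VO]] := compact_neighborhood cK oO KO.
pose Z := closure V `\` V.
have cZ : compact Z.
  by rewrite /Z setDE; apply: compact_closedI => //; exact: open_closedC.
have ZOK z : Z z -> (O `\` K) z by move=> [/VO Oz nVz]; split=> // /KV.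
have [D' [D'Z ZD']] : exists D' : seq 'rV[R]_d, (forall z, z \in D' -> Z z) /\
    forall x, Z x -> exists2 z, z \in D' & comp z x.
  apply: compact_pointwise_cover => // z /ZOK Az; split.
    exact: open_connected_component.
  exact: connected_component_refl.
have compO z : comp z `<=` O by move=> y /connected_component_sub[].
pose T := closure V `|`
  \big[setU/set0]_(z <- D' | z \in hull_in O K `\` K) closure (comp z).
have cT : compact T.
  apply: compactU => //; apply: bigsetU_compact => z /[!inE] -[[//|[OKz cz] _]].
  apply: (subclosed_compact _ cz); first exact: closed_closure.
  by move=> y cy; split => //; exact: closure_sub_compactI cz _ cy.
have HT : hull_in O K `<=` T.
  move=> x [/KV Vx|[OKx cx]]; first by left; exact: subset_closure.
  have [|ncVx] := pselect (closure V x); first by left.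
  right.
  have cxO : closure (comp x) `<=` O by exact: closure_sub_compactI cx.
  have Cx : comp x x by exact: connected_component_refl.
  (* A component missing [V] would have no limit point on [K], hence be closed, and so be compact,
     open and non-empty. *)
  have [y [Cy Vy]] : (comp x `&` V) !=set0.
    apply: contrapT => CV0.
    have cCE : closure (comp x) `<=` comp x.
      move=> y cy; apply: (closure_component_sub oOK); split => //.
      split; first exact: cxO.
      move=> /KV Vy; apply: CV0.
      by apply: cy; exact: open_nbhs_nbhs.
    apply: (@open_not_compact _ _ (comp x)) => //.
    - exact: open_connected_component.
    - by exists x.
    - apply: (subclosed_compact _ cx); first exact: cCE.
      by move=> y Cy; split; [exact: subset_closure|exact: compO Cy].
  (* Without a point on [Z], the part of the component in [V] would be open and closed in it, hence
     everything, although [x] is outside [closure V]. *)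
  have [z [Cz Zz]] : (comp x `&` Z) !=set0.
    apply: contrapT => CZ0.
    have E : comp x `&` V = comp x `&` closure V.
      apply/seteqP; split=> z [Cz Vz]; split => //; first exact: subset_closure.
      by apply: contrapT => nVz; apply: CZ0; exists z.
    have CVE : comp x `&` V = comp x.
      apply: (@component_connected _ (O `\` K) x); first by exists y.
      - by exists V.
      - by exists (closure V) => //; exact: closed_closure.
    by apply: ncVx; move: Cx; rewrite -CVE => -[_] /subset_closure.
  have [z' D'z' Cz'z] := ZD' z Zz.
  have E : comp z' = comp x.
    by rewrite (same_connected_component Cz'z) (same_connected_component Cz).
  rewrite -bigcup_seq_cond; exists z'; last by rewrite E; exact: subset_closure.
  rewrite /= D'z' inE; split; last by case: (ZOK _ (D'Z _ D'z')).
  right; split; last by rewrite E.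
  exact/ZOK/D'Z.
pose N := [set x | (O `\` K) x /\ ~ compact (closure (comp x) `&` O)].
have oN : open N.
  rewrite openE => x [OKx ncx].
  have : nbhs x (comp x).
    apply: open_nbhs_nbhs; split; first exact: open_connected_component.
    exact: connected_component_refl.
  apply: filterS => y Cy; split; first exact: connected_component_sub Cy.
  by rewrite -(same_connected_component Cy).
suff -> : hull_in O K = T `&` ~` N.
  by apply: compact_closedI => //; exact: open_closedC.
apply/seteqP; split=> x.
  move=> Hx; split; first exact: HT.
  by move: Hx => [Kx [[]]|[_ cx] []].
move=> [Tx nNx].
have Ox : O x.
  case: Tx => [/VO//|]; rewrite -bigcup_seq_cond => -[z /= /andP[_]].
  by rewrite inE => -[[//|[_ cz] _]]; exact: closure_sub_compactI cz _.
have [Kx|nKx] := pselect (K x); first by left.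
by right; split => //; apply: contrapT => ncx; apply: nNx.
Qed.

End hull.

Lemma subharmonic_bounded_above (R : realType) (d : nat) (O A : set 'rV[R]_d)
    (u : 'rV[R]_d -> \bar R) :
  subharmonic O u -> compact A -> A `<=` O ->
  exists M : R, forall x, A x -> (u x <= M%:E)%E.
Proof.
move=> [uoo usc _] cA AO.
have : \forall n \near \oo, A `<=` (fun x => (u x < n%:R%:E)%E).
  apply: (proj1 (compact_near_coveringP A) cA) => x /AO Ox.
  have [a ua] : exists a : R, (u x < a%:E)%E.
    by move: (uoo _ Ox); case: (u x) => [r _|//|_];
      [exists (r + 1); rewrite lte_fin ltrDl|exists 0; rewrite ltNyr].
  near=> y n; have an : a <= n%:R by near: n; exact: nbhs_infty_ger.
  have ya : (u y < a%:E)%E by near: y; exact: usc.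
  exact: (lt_le_trans ya).
move=> H; near \oo => n; exists n%:R => x Ax; apply: ltW.
by move: x Ax; near: n.
Unshelve. all: by end_near. Qed.

(* A multiple of a barrier that is large on the boundary of a neighbourhood [V]
   of the hull takes over from [u] outside [V]. *)
Lemma subharmonic_extension (R : realType) (d : nat) (O K O' : set 'rV[R]_d)
    (u : 'rV[R]_d -> \bar R) (n : nat) :
  (0 < d)%N -> open O -> compact K -> K `<=` O ->
  open O' -> hull_in O K `<=` O' -> subharmonic O' u ->
  exists2 v : 'rV[R]_d -> \bar R, subharmonic O v &
    forall x, K x -> v x = maxe (u x) (- n%:R)%:E.
Proof.
move=> d0 oO cK KO oO' HO' uO'.
have HO := hull_in_sub KO.
have [V [oV HV cV VOO']] : exists V : set 'rV[R]_d, [/\ open V,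
    hull_in O K `<=` V, compact (closure V) & closure V `<=` O `&` O'].
  apply: compact_neighborhood; [exact: compact_hull_in|exact: openI|].
  by move=> x Hx; split; [exact: HO|exact: HO'].
pose Z := closure V `\` V.
have cZ : compact Z.
  by rewrite /Z setDE; apply: compact_closedI => //; exact: open_closedC.
have ZO z : Z z -> O z by move=> [/VOO'[]].
(* Scaling by at least [2 / s z] brings the value at [z] above 1; off [Z] the constant 0 is a dummy
   value. *)
have /choice[t tP] z : exists t, Z z -> barrier O K t /\ 1 < t z.
  have [Zz|] := pselect (Z z); last by exists (cst 0).
  have [|s bs sz] := separated_from_hull d0 oO cK KO (ZO _ Zz).
    by move=> /HV; case: Zz.
  exists (fun x => Num.max 1 (2 / s z) * s x) => _; split.
    by apply: barrier_scale bs; rewrite le_max lexx.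
  have : 2 / s z <= Num.max 1 (2 / s z) by rewrite le_max lexx orbT.
  rewrite ler_pdivrMr//; lra.
have [D [DZ ZD]] : exists D : seq 'rV[R]_d, (forall z, z \in D -> Z z) /\
    forall x, Z x -> exists2 z, z \in D & [set y | O y /\ 1 < t z y] x.
  apply: compact_pointwise_cover => // z Zz; have [[_ tc _] tz] := tP _ Zz.
  split; last by split => //; exact: ZO.
  rewrite openE => y [Oy ty]; near=> w; split.
    by near: w; exact: open_nbhs_nbhs.
  by near: w; apply: (cvgr_gt (t z y)) => //; exact: tc.
have [s bs sZ] : exists2 s, barrier O K s & forall y, Z y -> 1 < s y.
  have [s bs sD] : exists2 s, barrier O K s &
      forall y z, z \in D -> 1 < t z y -> 1 < s y.
    elim: D DZ {ZD} => [_|z D IH DZ].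
      (* The constant -1 is a barrier, which settles the case of an empty cover. *)
      exists (cst (-1)) => //; split; first exact: subharmonic_cst.
        by move=> x _; exact: cst_continuous.
      by [].
    have [w wD|s bs sD] := IH; first by apply: DZ; rewrite inE wD orbT.
    have [bt _] := tP _ (DZ _ (mem_head _ _)).
    exists (fun x => Num.max (t z x) (s x)); first exact: barrier_max.
    move=> y w; rewrite inE => /orP[/eqP ->|wD] ty; rewrite lt_max ?ty//.
    by rewrite (sD y w)// orbT.
  by exists s => // y /ZD[z zD [_]]; exact: sD.
pose u' x := maxe (u x) (- n%:R)%:E.
have u'O' : subharmonic O' u'.
  by apply: subharmonic_max => //; exact: subharmonic_cst.
have [M uM] := subharmonic_bounded_above uO' cV (fun x cx => (VOO' x cx).2).
(* [N >= 1] keeps [N * s] a barrier, [N >= M] makes it dominate [u] on [Z], and [N >= n] puts it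
   below the truncation level on [K]. *)
pose N := Num.max (1 + n%:R) M.
have N1 : 1 <= N by rewrite le_max lerDl ler0n.
have Nn : n%:R <= N by rewrite le_max lerDr ler01.
have NM : M <= N by rewrite le_max lexx orbT.
have [sO _ sK] := barrier_scale N1 bs.
exists (fun x => if x \in V then maxe (u' x) (N * s x)%:E else (N * s x)%:E).
  apply: subharmonic_glue u'O' sO _ => //; first by move=> x [/VOO'[]].
  move=> x Ox Zx; have s1 := sZ _ Zx; rewrite ge_max; apply/andP; split.
    apply: (le_trans (uM x _)); first by case: Zx.
    by rewrite lee_fin (le_trans NM)// ler_peMr ?(le_trans ler01 N1)// ltW.
  rewrite lee_fin; have := ler0n R n; nra.
move=> x Kx; rewrite mem_set; last by apply: HV; left.
rewrite max_l// /u' le_max lee_fin; apply/orP; right.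
have [_ _ /(_ _ Kx) sx] := bs; nra.
Unshelve. all: by end_near. Qed.

(** * Integration against charges *)

Lemma open_borelRd (R : realType) (d : nat) (A : set 'rV[R]_d) :
  open A -> measurable (A : set (borelRd R d)).
Proof. by move=> oA; exact: sub_sigma_algebra. Qed.

Lemma closed_borelRd (R : realType) (d : nat) (A : set 'rV[R]_d) :
  closed A -> measurable (A : set (borelRd R d)).
Proof.
move=> cA; rewrite -[A]setCK; apply: measurableC; apply: open_borelRd.
exact: closed_openC.
Qed.

Lemma measurable_subharmonic (R : realType) (d : nat) (O : set 'rV[R]_d)
    (u : 'rV[R]_d -> \bar R) :
  open O -> subharmonic O u -> measurable_fun (O : set (borelRd R d)) u.
Proof.
move=> oO [_ usc _]; apply: (measurability _ (ErealGenInftyO.measurableE R)).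
move=> /= _ [_ [a ->]] <-; rewrite preimage_itvNyo; apply: open_borelRd.
rewrite openE => x [Ox ux]; near=> y; split.
  by near: y; exact: open_nbhs_nbhs.
by near: y; exact: usc.
Unshelve. all: by end_near. Qed.

Section null_open.
Context {R : realType} {d : nat}.
Variable m : {measure set (borelRd R d) -> \bar R}.

(** Compactness replaces the possibly uncountable family by finitely many of its members. *)
Lemma compact_null (A : set 'rV[R]_d) (F : set (set 'rV[R]_d)) :
  compact A -> (forall V, F V -> open V /\ m V = 0%E) ->
  A `<=` \bigcup_(V in F) V -> m.-negligible A.
Proof.
move=> cA F0 AF.
have /choice[f fP] x : exists V : set 'rV[R]_d, A x -> F V /\ V x.
  have [/AF[V FV Vx]|] := pselect (A x); first by exists V.
  by exists set0.
have [s [sA As]] : exists s : seq 'rV[R]_d, (forall z, z \in s -> A z) /\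
    forall x, A x -> exists2 z, z \in s & f z x.
  apply: compact_pointwise_cover => // x Ax; have [Fx fx] := fP _ Ax.
  by have [] := F0 _ Fx.
have H : m.-negligible (\big[setU/set0]_(z <- s) (f z : set (borelRd R d))).
  rewrite big_seq; elim/big_ind: _ => [||z zs]; first exact: negligible_set0.
    by move=> ? ?; exact: negligibleU.
  have [/F0[oV V0] _] := fP _ (sA _ zs).
  by apply/negligibleP => //; exact: open_borelRd.
apply: negligibleS H; rewrite -bigcup_seq => x /As[z zs fzx].
by exists z.
Qed.

(** The union is exhausted by countably many sets [C n], bounded and at distance at least
    [n.+1%:R^-1] from its complement; their closures are compact subsets of it. This is what makes a
    charge vanish off its support. *)
Lemma bigcup_open_null (F : set (set 'rV[R]_d)) :
  (forall V, F V -> open V /\ m V = 0%E) -> m (\bigcup_(V in F) V) = 0%E.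
Proof.
move=> F0; set U := \bigcup_(V in F) V.
have oU : open U by apply: bigcup_open => V /F0[].
apply/negligibleP; first exact: open_borelRd.
pose C n := [set x : 'rV[R]_d | `|x| <= n%:R /\
  forall y, ~ U y -> n.+1%:R^-1 <= `|x - y|].
have UC : U `<=` \bigcup_n C n.
  move=> x Ux; have [e e0 He] := open_ball_disjoint oU Ux.
  near \oo => n; exists n => //; split.
    by near: n; exact: nbhs_infty_ger.
  move=> y /He; apply: le_trans; rewrite -[leRHS]invrK lef_pV2 ?posrE ?invr_gt0//.
  have : e^-1 <= n%:R by near: n; exact: nbhs_infty_ger.
  by move=> /le_trans; apply; rewrite ler_nat.
suff H : m.-negligible (\bigcup_n (C n : set (borelRd R d))).
  exact: (negligibleS _ H).
apply: negligible_bigcup => n.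
suff H : m.-negligible (closure (C n) : set (borelRd R d)).
  by apply: negligibleS H; exact: subset_closure.
apply: (compact_null (F := F)) => //.
  by apply: (@compact_closure_bounded _ _ _ n%:R) => x [].
move=> x /closure_norm_lt cx; apply: contrapT => nUx.
have n0 : 0 < n.+1%:R^-1 :> R by rewrite invr_gt0 ltr0n.
by have [y [_ /(_ _ nUx)]] := cx _ n0; rewrite distrC leNgt => /negP.
Unshelve. all: by end_near. Qed.

Lemma negligible_integral_ge0 (D K : set (borelRd R d))
    (f : borelRd R d -> \bar R) :
  measurable D -> measurable K -> K `<=` D -> m (~` K) = 0%E ->
  measurable_fun D f -> (forall x, D x -> 0 <= f x)%E ->
  (\int[m]_(x in D) f x = \int[m]_(x in K) f x)%E.
Proof.
move=> mD mK KD mK0 mf f0.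
rewrite (@ge0_negligible_integral _ _ _ _ _ (~` K))//; last exact: measurableC.
by rewrite setDE setCK setIidr.
Qed.

End null_open.

Lemma integral_funepos_fin_num (R : realType) (d : nat)
    (m : {finite_measure set (borelRd R d) -> \bar R}) (K : set (borelRd R d))
    (f : borelRd R d -> \bar R) (M : R) :
  measurable K -> measurable_fun K f -> (forall x, K x -> f x <= M%:E)%E ->
  (\int[m]_(x in K) (f^\+ x))%E \is a fin_num.
Proof.
move=> mK mf fM.
have mfp : measurable_fun K (f^\+)%E by exact: measurable_funepos.
rewrite ge0_fin_numE; last by apply: integral_ge0.
apply: (@le_lt_trans _ _ (\int[m]_(x in K) (Num.max M 0)%:E)%E).
  apply: ge0_le_integral => // x /fM fx.
  by rewrite funeposE EFin_max ge_max le_max fx/= le_max lexx orbT.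
by rewrite integral_cst// lte_mul_pinfty ?lee_fin ?le_max ?lexx ?orbT//
  -ge0_fin_numE// fin_num_measure.
Qed.

(** * Removal of the truncation *)

Section balayage_limit.
Context {R : realType} {d : nat}.
Variables (K : set (borelRd R d)) (f : borelRd R d -> \bar R).
Hypotheses (mK : measurable K) (mf : measurable_fun K f).
Local Open Scope ereal_scope.

Let g (n : nat) (x : borelRd R d) := maxe (f x) (- n%:R)%:E.

Let mg n : measurable_fun K (g n).
Proof. by apply: measurable_maxe => //; exact: measurable_cst. Qed.

Let gpos n x : (g n)^\+ x = f^\+ x.
Proof.
rewrite !funeposE /g -maxA (@max_r _ _ (- n%:R)%:E)//.
Qed.

Let gneg n x : (g n)^\- x = mine (f^\- x) n%:R%:E.
Proof.
have n0 := ler0n R n.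
rewrite !funenegE /g; case: (f x) => [r| |] /=.
- rewrite -EFin_max -!EFinN -!EFin_max -EFin_min; congr EFin.
  case: (leP r (- n%:R)%R) => h1; case: (leP (- r)%R 0%R) => h2;
    case: leP => h3; try case: leP => h4; lra.
- by rewrite maxNye min_l// lee_fin.
- by rewrite maxNye maxye /= opprK max_l ?lee_fin// min_r// leey.
Qed.

(** Truncation leaves the positive part alone, whose integrals are finite, and replaces the negative
    part by its minimum with [n], which increases to it. *)
Lemma le_integral_truncation (a b : {finite_measure set (borelRd R d) -> \bar R})
    (M : R) : (forall x, K x -> f x <= M%:E) ->
  (forall n, \int[a]_(x in K) maxe (f x) (- n%:R)%:E <=
             \int[b]_(x in K) maxe (f x) (- n%:R)%:E) ->
  \int[a]_(x in K) f x <= \int[b]_(x in K) f x.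
Proof.
move=> fM leab.
have mfp : measurable_fun K f^\+ by exact: measurable_funepos.
have mfn : measurable_fun K f^\- by exact: measurable_funeneg.
have pfin (m : {finite_measure set (borelRd R d) -> \bar R}) :
    \int[m]_(x in K) f^\+ x \is a fin_num by exact: integral_funepos_fin_num fM.
pose T (m : {finite_measure set (borelRd R d) -> \bar R}) n :=
  \int[m]_(x in K) mine (f^\- x) n%:R%:E.
have TE (m : {finite_measure set (borelRd R d) -> \bar R}) n :
    \int[m]_(x in K) maxe (f x) (- n%:R)%:E =
    \int[m]_(x in K) f^\+ x - T m n.
  rewrite integralE; congr (_ - _); apply: eq_integral => x _.
    exact: gpos.
  exact: gneg.
have mT n : measurable_fun K (fun x => mine (f^\- x) n%:R%:E).
  by apply: measurable_mine => //; exact: measurable_cst.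
have T0 n x : 0 <= mine (f^\- x) n%:R%:E.
  by rewrite le_min funeneg_ge0 lee_fin ler0n.
have Tcvg : T b @ \oo --> \int[b]_(x in K) f^\- x.
  have -> : \int[b]_(x in K) f^\- x =
      \int[b]_(x in K) limn (fun n => mine (f^\- x) n%:R%:E).
    apply: eq_integral => x _; apply/esym/cvg_lim => //.
    have := funeneg_ge0 f x; case: (f^\- x) => [r _|_|//].
      apply: cvg_near_cst; near=> n; rewrite min_l// lee_fin.
      by near: n; exact: nbhs_infty_ger.
    under eq_fun do rewrite min_r ?leey//.
    exact/cvgenyP.
  apply: cvg_monotone_convergence => //.
  move=> x _ p q pq; rewrite le_min ge_min lexx/= ge_min lee_fin ler_nat pq.
  by rewrite orbT.
have Ta n : T a n <= \int[a]_(x in K) f^\- x.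
  by apply: ge0_le_integral => // x _; rewrite ge_min lexx.
have Tge0 (m : {finite_measure set (borelRd R d) -> \bar R}) n :
    0 <= T m n by exact: integral_ge0.
rewrite integralE [leRHS]integralE.
have/fineK <- := pfin a; have/fineK Eb := pfin b; rewrite -Eb.
set p := fine _; set q := fine _ in Eb *.
have : 0 <= \int[a]_(x in K) f^\- x by apply: integral_ge0.
(* If this integral is infinite, the left-hand side is -oo. Otherwise the integrals [T b n] have a
   bound independent of [n], which passes to the limit. *)
case EA : (\int[a]_(x in K) f^\- x) => [r| |] r0 //; last by rewrite /= leNye.
have Tb n : T b n <= (q - (p - r))%:E.
  have := leab n; rewrite !TE -Eb.
  have/fineK <- := pfin a; rewrite -/p.
  have := Ta n; rewrite EA; have := Tge0 a n; have := Tge0 b n.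
  case: (T a n) => [t| |]//; case: (T b n) => [t'| |]//=.
  by rewrite !lee_fin; lra.
have : \int[b]_(x in K) f^\- x <= (q - (p - r))%:E.
  by apply: cvge_le Tcvg; apply: nearW.
have : 0 <= \int[b]_(x in K) f^\- x by apply: integral_ge0.
case: (\int[b]_(x in K) f^\- x) => [t| |]//.
by rewrite -!EFinB !lee_fin; lra.
Unshelve. all: by end_near. Qed.

End balayage_limit.

(** * Restriction of the integrals to a closed set containing the support *)

Section charge_restriction.
Context {R : realType} {d : nat}.
Variables (nu : {charge set (borelRd R d) -> \bar R}) (K : set 'rV[R]_d).
Hypotheses (cK : closed K) (suppK : charge_supp nu `<=` K).
Local Open Scope ereal_scope.

Let mK : measurable (K : set (borelRd R d)) := closed_borelRd cK.

Let mKC : measurable (~` (K : set (borelRd R d))).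
Proof. exact: measurableC. Qed.

Let abs0 : charge_abs nu (~` K) = 0.
Proof.
have m0 : charge_abs nu (~` charge_supp nu) = 0.
  by rewrite setCK; apply: bigcup_open_null => V [].
apply: (subset_measure0 mKC _ _ m0); last exact: subsetC.
by rewrite setCK; apply: open_borelRd; apply: bigcup_open => V [].
Qed.

Lemma charge_pos_setC0 : charge_pos nu (~` K) = 0.
Proof.
have p0 : 0 <= charge_pos nu (~` K) by exact: measure_ge0.
have n0 : 0 <= charge_neg nu (~` K) by exact: measure_ge0.
move/eqP: abs0; rewrite /charge_abs /charge_variation/= padde_eq0//.
by move=> /andP[/eqP].
Qed.

Lemma charge_neg_setC0 : charge_neg nu (~` K) = 0.
Proof.
have p0 : 0 <= charge_pos nu (~` K) by exact: measure_ge0.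
have n0 : 0 <= charge_neg nu (~` K) by exact: measure_ge0.
move/eqP: abs0; rewrite /charge_abs /charge_variation/= padde_eq0//.
by move=> /andP[_ /eqP].
Qed.

(** Both Jordan parts vanish off [K], so integrals over different domains, of functions agreeing on
    [K], can be compared there. *)
Lemma charge_int_restrict (D : set (borelRd R d)) (f g : 'rV[R]_d -> \bar R) :
  measurable D -> K `<=` D -> measurable_fun D f -> {in K, f =1 g} ->
  (charge_int_def nu D f <-> charge_int_def nu K g) /\
  charge_int nu D f = charge_int nu K g.
Proof.
move=> mD KD mf fg.
have mfp : measurable_fun D f^\+ by exact: measurable_funepos.
have mfn : measurable_fun D f^\- by exact: measurable_funeneg.
have E : charge_int_plus nu D f = charge_int_plus nu K g.
  rewrite /charge_int_plus; congr (_ + _).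
    rewrite (negligible_integral_ge0 mD mK KD charge_pos_setC0)//.
    by apply: eq_integral => x xK; rewrite !funeposE fg.
  rewrite (negligible_integral_ge0 mD mK KD charge_neg_setC0)//.
  by apply: eq_integral => x xK; rewrite !funenegE fg.
have E' : charge_int_minus nu D f = charge_int_minus nu K g.
  rewrite /charge_int_minus; congr (_ + _).
    rewrite (negligible_integral_ge0 mD mK KD charge_pos_setC0)//.
    by apply: eq_integral => x xK; rewrite !funenegE fg.
  rewrite (negligible_integral_ge0 mD mK KD charge_neg_setC0)//.
  by apply: eq_integral => x xK; rewrite !funeposE fg.
split; last by rewrite /charge_int E E'.
rewrite /charge_int_def E E'; split=> [] [_ ?]; split => //.
apply: (@eq_measurable_fun _ _ (borelRd R d) _ K f) => //.
exact: measurable_funS mf.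
Qed.

End charge_restriction.

Section one_signed.
Context {R : realType} {d : nat}.
Variables (nu : {charge set (borelRd R d) -> \bar R}) (K : set (borelRd R d)).
Hypothesis mK : measurable K.
Local Open Scope ereal_scope.

(** If both Jordan parts charged [K], the integral of -oo would take the undefined form oo - oo. *)
Lemma charge_int_def_ninfty :
  charge_int_def nu K (fun _ => -oo) ->
  charge_pos nu K = 0 \/ charge_neg nu K = 0.
Proof.
move=> [_ H]; have [|p0] := eqVneq (charge_pos nu K) 0; first by left.
have [|n0] := eqVneq (charge_neg nu K) 0; first by right.
exfalso; apply: H.
have fp : (fun _ : 'rV[R]_d => -oo : \bar R)^\+ = cst 0.
  by apply/funext => x; rewrite funeposE maxNye.
have fn : (fun _ : 'rV[R]_d => -oo : \bar R)^\- = cst +oo.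
  by apply/funext => x; rewrite funenegE/= maxye.
rewrite /charge_int_plus /charge_int_minus fp fn !integral0 !integral_cst//.
by rewrite !gt0_mulye ?add0e ?adde0// lt0e ?p0 ?n0/= ?measure_ge0.
Qed.

Lemma integral_null (m : {measure set (borelRd R d) -> \bar R})
    (f : borelRd R d -> \bar R) :
  m K = 0 -> measurable_fun K f -> \int[m]_(x in K) f x = 0.
Proof.
move=> K0 mf.
have mfp : measurable_fun K f^\+ by exact: measurable_funepos.
have mfn : measurable_fun K f^\- by exact: measurable_funeneg.
rewrite integralE (ge0_negligible_integral mK mK)//.
rewrite [X in _ - X](ge0_negligible_integral mK mK)//.
by rewrite setDv !integral_set0 sube0.
Qed.

Lemma charge_int_neg0 (f : borelRd R d -> \bar R) :
  measurable_fun K f -> charge_neg nu K = 0 ->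
  charge_int nu K f = \int[charge_pos nu]_(x in K) f x.
Proof.
move=> mf n0.
have mfp : measurable_fun K f^\+ by exact: measurable_funepos.
have mfn : measurable_fun K f^\- by exact: measurable_funeneg.
rewrite /charge_int /charge_int_plus /charge_int_minus [RHS]integralE.
by rewrite !(@integral_null (charge_neg nu))// !adde0.
Qed.

(** Finiteness of the integral of the positive part allows the minus sign to be taken out of the
    difference. *)
Lemma charge_int_pos0 (f : borelRd R d -> \bar R) :
  measurable_fun K f -> charge_pos nu K = 0 ->
  \int[charge_neg nu]_(x in K) f^\+ x \is a fin_num ->
  charge_int nu K f = - \int[charge_neg nu]_(x in K) f x.
Proof.
move=> mf p0 ffin.
have mfp : measurable_fun K f^\+ by exact: measurable_funepos.
have mfn : measurable_fun K f^\- by exact: measurable_funeneg.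
rewrite /charge_int /charge_int_plus /charge_int_minus [in RHS]integralE.
rewrite !(@integral_null (charge_pos nu))// !add0e [in RHS]addeC.
by rewrite fin_num_oppeD// oppeK.
Qed.

Lemma charge_int_def_one_signed (f : borelRd R d -> \bar R) :
  measurable_fun K f ->
  \int[charge_pos nu]_(x in K) f^\+ x \is a fin_num ->
  \int[charge_neg nu]_(x in K) f^\+ x \is a fin_num ->
  charge_pos nu K = 0 \/ charge_neg nu K = 0 -> charge_int_def nu K f.
Proof.
move=> mf pfin nfin sgn.
have mfp : measurable_fun K f^\+ by exact: measurable_funepos.
have mfn : measurable_fun K f^\- by exact: measurable_funeneg.
split => // -[]; rewrite /charge_int_plus /charge_int_minus.
case: sgn => m0.
  rewrite !(@integral_null (charge_pos nu))// !add0e => _ E.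
  by move: nfin; rewrite E.
rewrite !(@integral_null (charge_neg nu))// !adde0 => E.
by move: pfin; rewrite E.
Qed.

End one_signed.

(** * Transfer of the balayage inequality from [O] to neighbourhoods of the hull *)

Theorem theorem6 (R : realType) (d : nat) (hd : (0 < d)%N)
    (O : set 'rV[R]_d) (hO0 : O !=set0) (hO : Greenian O)
    (theta mu : {charge set (borelRd R d) -> \bar R})
    (htheta : compact (charge_supp theta) /\ charge_supp theta `<=` O)
    (hmu : compact (charge_supp mu) /\ charge_supp mu `<=` O)
    (hbal : balayage O (sbh O) theta mu) :
  let S := hull_in O (charge_supp mu `|` charge_supp theta) in
  balayage S (sbh_near S) theta mu /\
  (forall O' : set 'rV[R]_d, open O' -> S `<=` O' ->
     balayage O' (sbh O') theta mu).
Proof.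
set K := charge_supp mu `|` charge_supp theta => S.
have oO : open O by case: hO.
have cK : compact K by apply: compactU; [exact: hmu.1|exact: htheta.1].
have KO : K `<=` O by move=> x [/hmu.2|/htheta.2].
have clK : closed K by apply: compact_closed cK; exact: norm_hausdorff.
have mK : measurable (K : set (borelRd R d)) by exact: closed_borelRd.
have KS : K `<=` S by move=> x; left.
have thK : charge_supp theta `<=` K by move=> x; right.
have muK : charge_supp mu `<=` K by move=> x; left.
(* All three domains [O], [S] and [O'] are brought back to [K]. *)
have reduce (D : set (borelRd R d)) f g : measurable D -> K `<=` D ->
    measurable_fun D f -> {in K, f =1 g} ->
    [/\ charge_int_def theta D f, charge_int_def mu D f
      & (charge_int theta D f <= charge_int mu D f)%E] <->
    [/\ charge_int_def theta K g, charge_int_def mu K g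
      & (charge_int theta K g <= charge_int mu K g)%E].
  move=> mD KD mf fg.
  have [dt it] := charge_int_restrict clK thK mD KD mf fg.
  have [dm im] := charge_int_restrict clK muK mD KD mf fg.
  by rewrite it im; split=> -[/dt ? /dm ?].
have balK v : sbh O v -> [/\ charge_int_def theta K v, charge_int_def mu K v
    & (charge_int theta K v <= charge_int mu K v)%E].
  move=> Ov; apply/(reduce O v v) => //; first exact: open_borelRd.
  - exact: measurable_subharmonic.
  - exact: hbal.
have bounded v W : open W -> K `<=` W -> sbh W v ->
    measurable_fun (K : set (borelRd R d)) v /\
    exists M : R, forall x, K x -> (v x <= M%:E)%E.
  move=> oW KW Wv; split; last exact: subharmonic_bounded_above Wv cK KW.
  apply: measurable_funS (measurable_subharmonic oW Wv) => //.
  exact: open_borelRd.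
have [dth dmu _] := balK _ (subharmonic_ninfty O).
have sth := charge_int_def_ninfty mK dth.
have smu := charge_int_def_ninfty mK dmu.
(* The two charges can be given a common sign: if their signs are opposite, testing with the
   constant -1 or 1 forces both to be null on [K]. *)
have sgn : (charge_neg theta K = 0 /\ charge_neg mu K = 0)%E \/
    (charge_pos theta K = 0 /\ charge_pos mu K = 0)%E.
  have cint (nu : {charge set (borelRd R d) -> \bar R}) (c : R) :
      (charge_pos nu K = 0 ->
        charge_int nu K (cst c%:E) = - (c%:E * charge_neg nu K))%E /\
      (charge_neg nu K = 0 ->
        charge_int nu K (cst c%:E) = c%:E * charge_pos nu K)%E.
    have mc : measurable_fun (K : set (borelRd R d)) (cst c%:E : _ -> \bar R).
      exact: measurable_cst.
    split=> [p0|n0]; last by rewrite charge_int_neg0// integral_cst.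
    rewrite charge_int_pos0 ?integral_cst//.
    exact: (@integral_funepos_fin_num _ _ _ _ _ c).
  have null (x y : \bar R) :
      (0 <= x -> 0 <= y -> x <= - y -> x = 0 /\ y = 0)%E.
    move=> x0 y0 xy; have yx : (x + y <= 0)%E.
      by move: x0 y0 xy; case: x => [x| |]//; case: y => [y| |]//;
        rewrite ?lee_fin//=; lra.
    have : (x + y == 0)%E by rewrite eq_le yx adde_ge0.
    by rewrite padde_eq0// => /andP[/eqP -> /eqP ->].
  have ge0 (nu : {charge set (borelRd R d) -> \bar R}) :
      (0 <= charge_pos nu K /\ 0 <= charge_neg nu K)%E.
    by split; exact: measure_ge0.
  case: sth smu => th0 [] mu0; [by right| | |by left].
    have [_ _] := balK _ (subharmonic_cst O (-1) hd).
    rewrite (cint theta _).1// (cint mu _).2// EFinN !mulNe !mul1e oppeK.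
    by case/null => [||-> _]; [exact: (ge0 _).2|exact: (ge0 _).1|left].
  have [_ _] := balK _ (subharmonic_cst O 1 hd).
  rewrite (cint theta _).2// (cint mu _).1// !mul1e.
  by case/null => [||_ ->]; [exact: (ge0 _).1|exact: (ge0 _).2|left].
have main W v : open W -> S `<=` W -> sbh W v ->
    [/\ charge_int_def theta K v, charge_int_def mu K v
      & (charge_int theta K v <= charge_int mu K v)%E].
  move=> oW SW Wv.
  have [mv [M vM]] := bounded v W oW (subset_trans KS SW) Wv.
  have fin (m : {finite_measure set (borelRd R d) -> \bar R}) :
      (\int[m]_(x in K) v^\+ x)%E \is a fin_num.
    exact: (integral_funepos_fin_num m mK mv vM).
  have finp (nu : {charge set (borelRd R d) -> \bar R}) :
      (\int[charge_pos nu]_(x in K) v^\+ x)%E \is a fin_num by exact: fin.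
  have finn (nu : {charge set (borelRd R d) -> \bar R}) :
      (\int[charge_neg nu]_(x in K) v^\+ x)%E \is a fin_num by exact: fin.
  split.
  - exact: (charge_int_def_one_signed mK mv (finp _) (finn _) sth).
  - exact: (charge_int_def_one_signed mK mv (finp _) (finn _) smu).
  have trunc n : let vn := fun x => maxe (v x) (- n%:R)%:E in
      (charge_int theta K vn <= charge_int mu K vn)%E.
    have [w Ow wv] := subharmonic_extension n hd oO cK KO oW SW Wv.
    have [mw _] := bounded w O oO KO Ow.
    have wE : {in K, w =1 (fun x => maxe (v x) (- n%:R)%:E)}.
      by move=> x /[!inE]; exact: wv.
    have /(reduce K w _ mK (@subset_refl _ K) mw wE) [] := balK w Ow => //.
  have mvn n : measurable_fun (K : set (borelRd R d))
      (fun x => maxe (v x) (- n%:R)%:E).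
    by apply: measurable_maxe => //; exact: measurable_cst.
  have vnM n x : K x -> (maxe (v x) (- n%:R)%:E <= (Num.max M 0)%:E)%E.
    move=> /vM vx; rewrite EFin_max ge_max !le_max vx/= !lee_fin.
    by rewrite oppr_le0 ler0n orbT.
  case: sgn => -[nth nmu].
    rewrite !charge_int_neg0//.
    apply: (le_integral_truncation mK mv vM) => n.
    by have := trunc n; rewrite /= !charge_int_neg0.
  (* For non-positive charges the minus signs swap the roles of [theta] and [mu] in the passage to
     the limit. *)
  rewrite !charge_int_pos0// leeN2.
  apply: (le_integral_truncation mK mv vM) => n.
  have := trunc n; rewrite /= !charge_int_pos0 ?leeN2//;
    exact: integral_funepos_fin_num (vnM n).
split => [u [W [v [oW SW Wv uv]]]|O' oO' SO' u O'u].
  apply/(reduce S u v) => //; last exact: main Wv.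
  (* [S] is a Borel set because the hull is compact. *)
  - apply: closed_borelRd; apply: compact_closed; first exact: norm_hausdorff.
    exact: compact_hull_in.
  - apply: (@eq_measurable_fun _ _ (borelRd R d) _ S v) => //.
      by move=> x /[!inE] /uv.
    apply: measurable_funS (measurable_subharmonic oW Wv) => //.
    exact: open_borelRd.
  - by move=> x /[!inE] /KS /uv.
apply/(reduce O' u u) => //; last exact: main O'u.
- exact: open_borelRd.
- exact: subset_trans SO'.
- exact: measurable_subharmonic.
Qed.
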